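(* If $G$ is a 2-connected noncomplete graph with diameter $diam(G)=3$, then $pc(G)=2$.
   Context: All graphs are simple, finite and undirected. Let $G$ be a nontrivial connected graph with an edge-coloring $c:E(G)\to\{1,\dots,t\}$ (adjacent edges may receive the same color). A path in $G$ is called proper if no two consecutive edges of the path receive the same color (a single edge is a proper path). The colored graph is proper connected if every pair of distinct vertices is connected by at least one proper path. The proper connection number $pc(G)$ is the smallest number of colors in an edge-coloring of $G$ that makes $G$ proper connected. *)

(* Defs.v *)
From mathcomp Require Import all_boot.

Set Implicit Arguments.
Unset Strict Implicit.
Unset Printing Implicit Defensive.

(* A simple graph on a finite vertex type is a symmetric irreflexive
   [e : rel T].  As in [path.v], a walk is a start vertex [x] together with the
   list [p] of the subsequent vertices; its length is [size p]. *)

Definition simple_path (T : finType) (e : rel T) (x y : T) (p : seq T) : bool :=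
  [&& path e x p, uniq (x :: p) & last x p == y].

Definition complete_graph (T : finType) (e : rel T) : Prop :=
  forall x y : T, x != y -> e x y.

Definition delete_vertices (T : finType) (e : rel T) (X : {set T}) : rel T :=
  [rel x y | [&& x \notin X, y \notin X & e x y]].

Definition k_connected (T : finType) (e : rel T) (k : nat) : Prop :=
  k < #|T| /\
  forall X : {set T}, #|X| < k ->
    {in ~: X &, forall x y, connect (delete_vertices e X) x y}.

(* [#|T|] plays the role of an infinite distance: the distance between two
   vertices joined by a path is less than [#|T|]. *)
Definition dist (T : finType) (e : rel T) (x y : T) : nat :=
  find (fun n => [exists p : n.-tuple T, path e x p && (last x p == y)])
       (iota 0 #|T|).

Definition diam (T : finType) (e : rel T) : nat :=
  \max_(x : T) \max_(y : T) dist e x y.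

(* A colouring is a function on all vertex sets, but only its values on the
   edges [[set u; v]] of the graph are ever used. *)
Definition path_colors (T : finType) (K : Type) (c : {set T} -> K)
    (x : T) (p : seq T) : seq K :=
  pairmap (fun u v => c [set u; v]) x p.

Definition proper_path (T : finType) (e : rel T) (K : eqType)
    (c : {set T} -> K) (x y : T) (p : seq T) : bool :=
  simple_path e x y p && sorted (fun a b => a != b) (path_colors c x p).

Definition proper_connected (T : finType) (e : rel T) (K : eqType)
    (c : {set T} -> K) : Prop :=
  forall x y : T, x != y -> exists p : seq T, proper_path e c x y p.

Definition proper_connectable (T : finType) (e : rel T) (t : nat) : Prop :=
  exists c : {set T} -> 'I_t, proper_connected e c.

(* Intended for connected graphs with at least two vertices. *)
Definition is_pc (T : finType) (e : rel T) (k : nat) : Prop :=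
  proper_connectable e k /\ forall t, proper_connectable e t -> k <= t.

Lemma dist_leP (T : finType) (e : rel T) (x y : T) (n : nat) :
  connect e x y ->
  dist e x y <= n <->
  (exists2 p, path e x p /\ last x p = y & size p <= n).
Proof.
set P := fun m => [exists p : m.-tuple T, path e x p && (last x p == y)].
have PP p : path e x p -> last x p = y -> P (size p).
  by move=> pp lp; apply/existsP; exists (in_tuple p); rewrite pp lp eqxx.
have small p : path e x p -> last x p = y ->
    exists q, [/\ path e x q, last x q = y, size q < #|T| & size q <= size p].
  move=> pp <-; case/shortenP: pp => q qp uq sub; exists q; split=> //.
    by have := max_card (mem (x :: q)); rewrite (card_uniqP uq).
  by apply: uniq_leq_size => //; case/andP: uq.
move=> /connectP[p0 pp0 /esym lp0].
have [q0 [pq0 lq0 sq0 _]] := small _ pp0 lp0.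
have hasP0 : has P (iota 0 #|T|).
  by apply/hasP; exists (size q0); [rewrite mem_iota | exact: PP].
have Pd : P (dist e x y).
  have := nth_find 0 hasP0; rewrite nth_iota ?add0n //.
  by move: hasP0; rewrite has_find size_iota.
split=> [le_n|[p [pp lp] le_pn]].
  have /existsP[p /andP[pp /eqP lp]] := Pd.
  by exists p; rewrite ?size_tuple.
have [q [pq lq sq le_qp]] := small _ pp lp.
apply: leq_trans (leq_trans le_qp le_pn); rewrite leqNgt; apply/negP => lt.
have := before_find 0 lt; rewrite nth_iota ?add0n //.
by rewrite [X in X = false](PP _ pq lq).
Qed.

(* Main.v *)
Require Import Defs.
From mathcomp Require Import all_boot.
From Stdlib Require Import Classical.

(** Colours are booleans. Call a set [X] of vertices strong if any two of its
    vertices [x], [y] are joined inside [X] by an alternating path starting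
    at [x] with either prescribed colour. Even alternating cycles are strong and
    the union of two strong sets that meet is strong; hence an ear closing an
    even cycle extends a strong set, and more generally a properly connected
    set, as does a new vertex with two neighbours in the set.

    If all cycles are odd, the graph is an odd cycle and has a Hamiltonian path.
    Otherwise let [H] be a maximal strong set using only edges of a bipartite
    subgraph. No ear on [H] closes an even cycle, and the parities of three legs
    from a common vertex show that a component of [G - H] sends at most two
    edges to [H]. So it is a single vertex with two neighbours in [H], or it is
    attached by two disjoint edges [d1 u1], [d2 u2]; by the diameter, all its
    vertices are then within distance one of [d1] or [d2].

    If there is at most one component of the second kind, colour a path from
    [u2] through [d2] to [d1] alternately and extend greedily. If there are several,
    the diameter forces each of them to be a single edge [d1 d2]. Replace [H] by
    a maximal strong set [S] (using all edges). Two remaining such edges cannot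
    have a common neighbour in [S], and among the edges joining their neighbours
    one has colour [false]: otherwise an even cycle would extend [S]. Colouring
    [u1 d1], [d2 u2] with [true] and [d1 d2] with [false] then connects all of
    them. *)

Set Implicit Arguments.
Unset Strict Implicit.
Unset Printing Implicit Defensive.

(** * Alternating paths and strong sets *)

Section Sequences.
Variable T : eqType.
Implicit Types (x y z : T) (p q : seq T) (r : rel T).

Lemma first_hit (A : pred T) x p :
  A (last x p) ->
  exists p1 p2, [/\ p = p1 ++ p2, A (last x p1) & ~~ has A (belast x p1)].
Proof.
elim: p x => [|y p IHp] x /= Ax; first by exists [::], [::].
have [Axx|nAx] := boolP (A x); first by exists [::], (y :: p).
have [p1 [p2 [-> Ap1 nAp1]]] := IHp y Ax.
by exists (y :: p1), p2; rewrite /= negb_or nAx.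
Qed.

Lemma rev_belast_cons x p : last x p :: rev (belast x p) = rev (x :: p).
Proof. by rewrite [in RHS]lastI rev_rcons. Qed.

Lemma last_rev_belast x p : last (last x p) (rev (belast x p)) = x.
Proof. by case: p => //= y p; rewrite rev_cons last_rcons. Qed.

Lemma rev_belastK x p : rev (belast (last x p) (rev (belast x p))) = p.
Proof.
have := rev_belast_cons (last x p) (rev (belast x p)).
by rewrite last_rev_belast rev_belast_cons revK => -[].
Qed.

Lemma path_rev_belast r x p :
  symmetric r -> path r (last x p) (rev (belast x p)) = path r x p.
Proof. by move=> r_sym; rewrite rev_path; apply: eq_path => y z;
  rewrite r_sym. Qed.

End Sequences.

Lemma connect_uniq_path (T : finType) (r : rel T) (x y : T) :
  connect r x y -> exists p, [/\ path r x p, uniq (x :: p) & last x p = y].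
Proof.
case/connectP=> p rp ->; case/shortenP: rp => q rq uq _.
by exists q.
Qed.

Section Alternating.
Variable T : finType.
Implicit Types (c : {set T} -> bool) (r : rel T) (X Y S : {set T}).
Implicit Types (x y z u v : T) (p q : seq T) (a b : bool).

Fixpoint apath r c a x p :=
  if p is y :: p' then [&& r x y, c [set x; y] == a & apath r c (~~ a) y p']
  else true.

Definition alink r c X a x y p :=
  [&& apath r c a x p, uniq (x :: p), last x p == y & all [in X] p].

(** The colour is prescribed at the start [x] only; the colour on arrival at [y] is left open. *)
Definition strong r c X := forall x y a,
  x \in X -> y \in X -> x != y -> exists p, alink r c X a x y p.

Definition pconn r c X := forall x y,
  x \in X -> y \in X -> x != y -> exists a p, alink r c X a x y p.

Lemma apath_cat r c a x p q :
  apath r c a x (p ++ q) =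
  apath r c a x p && apath r c (a (+) odd (size p)) (last x p) q.
Proof.
elim: p a x => [|y p IHp] a x /=; first by rewrite addbF.
by rewrite IHp addNb addbN -!andbA.
Qed.

Lemma apath_path r c a x p : apath r c a x p -> path r x p.
Proof. by elim: p a x => //= y p IHp a x /and3P[-> _ /IHp]. Qed.

Lemma apath_subrel r r' c a x p :
  subrel r r' -> apath r c a x p -> apath r' c a x p.
Proof.
move=> rr'; elim: p a x => //= y p IHp a x /and3P[/rr'-> -> /IHp].
exact.
Qed.

(** An alternating walk of n > 0 edges beginning with [a] ends with colour [~~ (a (+) odd n)], which
    is the first colour of its reversal. *)
Lemma apath_rev r c a x p :
  symmetric r -> apath r c a x p ->
  apath r c (~~ (a (+) odd (size p))) (last x p) (rev (belast x p)).
Proof.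
move=> r_sym; elim: p a x => [|y p IHp] a x //= /and3P[rxy cxy /IHp{}IHp].
rewrite rev_cons -cats1 apath_cat addbN -addNb IHp last_rev_belast /=.
rewrite size_rev size_belast r_sym rxy setUC !addNb negbK -addbA addbb addbF.
by rewrite cxy.
Qed.

Lemma apath_congr r r' c c' S a x p :
  {in S &, forall u v, r u v = r' u v /\ c [set u; v] = c' [set u; v]} ->
  x \in S -> all [in S] p -> apath r c a x p = apath r' c' a x p.
Proof.
move=> eqS; elim: p a x => //= y p IHp a x Sx /andP[Sy Sp].
by have [-> ->] := eqS x y Sx Sy; rewrite IHp.
Qed.

Lemma alink_congr r r' c c' S a x y p :
  {in S &, forall u v, r u v = r' u v /\ c [set u; v] = c' [set u; v]} ->
  x \in S -> alink r c S a x y p -> alink r' c' S a x y p.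
Proof.
move=> eqS Sx /and4P[ap up lp Sp]; apply/and4P; split=> //.
by rewrite -(apath_congr _ eqS).
Qed.

Lemma strong_congr r r' c c' S :
  {in S &, forall u v, r u v = r' u v /\ c [set u; v] = c' [set u; v]} ->
  strong r c S -> strong r' c' S.
Proof.
move=> eqS str x y a Sx Sy xy; have [p lp] := str x y a Sx Sy xy.
by exists p; apply: alink_congr lp.
Qed.

Lemma pconn_congr r c c' S :
  (forall A : {set T}, A \subset S -> c' A = c A) ->
  pconn r c S -> pconn r c' S.
Proof.
move=> eqS str x y Sx Sy xy; have [a [p lp]] := str x y Sx Sy xy.
exists a, p; apply: alink_congr lp => // u v Su Sv.
by split=> //; rewrite eqS // subUset !sub1set Su.
Qed.

Lemma alink_sub r c X Y a x y p :
  X \subset Y -> alink r c X a x y p -> alink r c Y a x y p.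
Proof.
move=> XY /and4P[ap up lp Sp]; apply/and4P; split=> //.
by apply: sub_all Sp => z; apply: (subsetP XY).
Qed.

Lemma strong_pconn r c X : strong r c X -> pconn r c X.
Proof. by move=> str x y Xx Xy /(str x y true Xx Xy)[p]; exists true, p. Qed.

(** The two paths leave [z] with opposite colours, so [p] traversed backwards and then [q] alternate
    at [z] too. *)
Lemma alink_vee r c X a z p q :
  symmetric r -> apath r c a z p -> apath r c (~~ a) z q ->
  uniq (z :: p ++ q) -> all [in X] (z :: p ++ q) ->
  alink r c X (~~ (a (+) odd (size p))) (last z p) (last z q)
    (rev (belast z p) ++ q).
Proof.
move=> r_sym ap aq upq Xpq; apply/and4P; split.
- rewrite apath_cat apath_rev // last_rev_belast size_rev size_belast.
  by rewrite addNb -addbA addbb addbF.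
- rewrite -cat_cons rev_belast_cons cat_uniq rev_uniq.
  by rewrite has_sym (eq_has_r (mem_rev _)) has_sym -cat_uniq.
- by rewrite last_cat last_rev_belast.
have : all [in X] (rev (z :: p) ++ q) by rewrite all_cat all_rev -all_cat.
by rewrite -rev_belast_cons => /andP[].
Qed.

Lemma alink_sym r c X a x y p :
  symmetric r -> x \in X -> alink r c X a x y p ->
  exists b q, alink r c X b y x q /\ size q = size p.
Proof.
move=> r_sym Xx /and4P[ap up /eqP <- Xp].
exists (~~ (a (+) odd (size p))), (rev (belast x p) ++ [::]).
split; first by apply: alink_vee; rewrite // cats0 //= Xx.
by rewrite cats0 size_rev size_belast.
Qed.

(** Follow [p] to its first vertex [w] in [Y], then continue inside [Y] with the colour that
    alternation demands at [w]. The initial piece meets [Y] only in [w], so the result is a simple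
    path. *)
Lemma alink_enter r c X Y a x y z p :
  alink r c X a x z p -> z \in Y -> x \notin Y -> y \in Y ->
  (forall w b, w \in Y -> w != y -> exists q, alink r c Y b w y q) ->
  exists q, alink r c (X :|: Y) a x y q.
Proof.
move=> /and4P[ap up /eqP lp Xp] Yz nYx Yy toy.
have [|p1 [p2 [Dp Yw nYp1]]] := @first_hit _ [in Y] x p; first by rewrite lp.
move: ap up Xp; rewrite Dp apath_cat -cat_cons cat_uniq all_cat.
move=> /andP[ap1 _] /and3P[up1 _ _] /andP[Xp1 _].
set w := last x p1 in Yw.
have [wy|wNy] := eqVneq w y.
  exists p1; apply/and4P; split=> //; first exact/eqP.
  by apply: sub_all Xp1 => v Xv; apply/setUP; left.
have [q /and4P[aq uq /eqP lq Yq]] := toy w (a (+) odd (size p1)) Yw wNy.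
exists (p1 ++ q); apply/and4P; split.
- by rewrite apath_cat ap1.
- move: uq; rewrite cons_uniq => /andP[wq uq];
    rewrite -cat_cons cat_uniq up1 uq andbT has_sym.
  rewrite lastI has_rcons negb_or wq; apply: contra nYp1.
  by case/hasP=> v v1 qv; apply/hasP; exists v => //; apply: (allP Yq).
- by rewrite last_cat lq.
rewrite all_cat; apply/andP; split.
  by apply: sub_all Xp1 => v Xv; apply/setUP; left.
by apply: sub_all Yq => v Yv; apply/setUP; right.
Qed.

(** Both sets are needed only when the start lies in just one of them and the end in the other: head
    for the common vertex [z] and apply [alink_enter]. *)
Lemma strongU r c X Y z :
  strong r c X -> strong r c Y -> z \in X -> z \in Y -> strong r c (X :|: Y).
Proof.
suff main X' Y' : strong r c X' -> strong r c Y' -> z \in X' -> z \in Y' ->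
    forall x y a, x \in X' -> y \in X' :|: Y' -> x != y ->
    exists p, alink r c (X' :|: Y') a x y p.
  move=> sX sY Xz Yz x y a /setUP[Xx|Yx] Ay; first exact: main.
  by rewrite setUC; apply: main => //; rewrite setUC.
move=> sX sY Xz Yz x y a Xx Ay xy.
have [Yx|nYx] := boolP (x \in Y').
  case/setUP: Ay => [Xy|Yy].
    by have [p lp] := sX x y a Xx Xy xy; exists p; apply: alink_sub lp;
      apply: subsetUl.
  by have [p lp] := sY x y a Yx Yy xy; exists p; apply: alink_sub lp;
    apply: subsetUr.
case/setUP: Ay => [Xy|Yy].
  by have [p lp] := sX x y a Xx Xy xy; exists p; apply: alink_sub lp;
    apply: subsetUl.
have xz : x != z by apply: contraNneq nYx => ->.
have [p lp] := sX x z a Xx Xz xz.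
by apply: alink_enter lp _ _ _ _ => // w b Yw wy; apply: sY.
Qed.

(** A path in [X] arrives in [Y] with an uncontrolled colour, but the strength of [Y] allows any
    continuation. Paths from [Y] to [X] are reversals, so their start colour cannot be chosen. *)
Lemma pconnU r c X Y z :
  symmetric r -> pconn r c X -> strong r c Y -> z \in X -> z \in Y ->
  pconn r c (X :|: Y).
Proof.
move=> r_sym pX sY Xz Yz.
have main x y : x \in X -> x \notin Y -> y \in Y ->
    exists a p, alink r c (X :|: Y) a x y p.
  move=> Xx nYx Yy; have xz : x != z by apply: contraNneq nYx => ->.
  have [a [p lp]] := pX x z Xx Xz xz; exists a.
  by apply: alink_enter lp _ _ _ _ => // w b Yw wy; apply: sY.
have sym x y : x \in X :|: Y -> (exists a p, alink r c (X :|: Y) a x y p) ->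
    exists a p, alink r c (X :|: Y) a y x p.
  by move=> Ax [a [p /(alink_sym r_sym Ax)[b [q [lq _]]]]]; exists b, q.
move=> x y Ax Ay xy.
have inX : x \in X -> y \in X -> exists a p, alink r c (X :|: Y) a x y p.
  move=> Xx Xy; have [a [p lp]] := pX x y Xx Xy xy.
  by exists a, p; apply: alink_sub lp; apply: subsetUl.
have inY : x \in Y -> y \in Y -> exists a p, alink r c (X :|: Y) a x y p.
  move=> Yx Yy; have [p lp] := sY x y true Yx Yy xy.
  by exists true, p; apply: alink_sub lp; apply: subsetUr.
have [Xx|Yx] := setUP Ax; have [Xy|Yy] := setUP Ay; try by auto.
  by have [Yx|nYx] := boolP (x \in Y); auto.
by have [Yy|nYy] := boolP (y \in Y); auto.
Qed.

(** The closed walk has [size q + 1] edges, an even number, so its last and first edges differ in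
    colour and it may be started anywhere. *)
Lemma alternating_cycle_rot r c n x q a :
  uniq (x :: q) -> apath r c a x (rcons q x) -> odd (size q) ->
  forall y p, rot n (x :: q) = y :: p ->
  uniq (y :: p) /\ (exists b, apath r c b y (rcons p y)) /\ odd (size p).
Proof.
move=> uq aq oq; elim: n => [|n IHn] y p.
  by rewrite rot0 => -[<- <-]; split=> //; split=> //; exists a.
have [lt_n|le_n] := ltnP n (size (x :: q)); last first.
  rewrite rot_oversize; last exact: leqW.
  by move=> E; apply: IHn; rewrite rot_oversize.
rewrite rotS //; case: (rot n _) IHn =>
  // x' q' /(_ _ _ erefl)[uq' [[b aq'] oq']].
case: q' => [|z q'] // in uq' aq' oq' *; rewrite rot1_cons /= => -[<- <-].
split; first by have: uniq (rcons (z :: q') x') by rewrite rcons_uniq.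
split; last by rewrite size_rcons.
move: aq' => /= /and3P[rx cx aq']; exists (~~ b).
rewrite -cats1 apath_cat aq' size_rcons last_rcons /= rx (eqP cx) andbT.
by move: oq' => /= /negbTE ->; rewrite addbT negbK.
Qed.

(** The two arcs of the cycle from [y] to [w] leave [y] with opposite colours and so serve both
    prescriptions. *)
Lemma alternating_cycle_strong r c a x q :
  symmetric r -> uniq (x :: q) -> apath r c a x (rcons q x) ->
  odd (size q) -> strong r c [set z in x :: q].
Proof.
move=> r_sym uq aq oq y w b; rewrite !in_set => qy qw yw.
have [i q' Dq'] := rot_to qy.
have [uq' [[d aq'] oq']] := alternating_cycle_rot uq aq oq Dq'.
have sub z : z \in y :: q' -> z \in [set z in x :: q].
  by rewrite -Dq' mem_rot in_set.
move: qw; rewrite -(mem_rot i) Dq' inE eq_sym (negPf yw) /= => qw.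
case/path.splitP: qw => p1 p2 in uq' aq' oq' sub *.
move: aq'; rewrite rcons_cat apath_cat last_rcons size_rcons => /andP[ap1 ap2].
have [->|/eqP] := eqVneq b d.
  exists (rcons p1 w); apply/and4P; split=> //; last 1 first.
  - by apply/allP => z p1z; apply: sub; rewrite inE mem_cat p1z orbT.
  - by move: uq'; rewrite -cat_cons cat_uniq => /andP[].
  by rewrite last_rcons.
move/eqP; rewrite eq_sym -addbT => bd.
exists (rcons (rev p2) w); apply/and4P; split.
- move: (apath_rev r_sym ap2).
  rewrite last_rcons belast_rcons rev_cons size_rcons.
  congr apath; move: oq' bd; rewrite size_cat size_rcons oddD /=.
  by case: (odd _) (odd _) (b) (d) => [] [] [] [].
- move: uq';
    rewrite /= mem_cat cat_uniq rcons_uniq !mem_rcons !inE negb_or mem_rev.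
  case/and3P=> /andP[/norP[yw' yp1] yp2] _ /andP[hp2 up2].
  rewrite (negPf yw') yp2 rcons_uniq mem_rev rev_uniq up2 andbT /=.
  by apply: contra hp2 => wp2; apply/hasP; exists w;
    rewrite // mem_rcons mem_head.
- by rewrite last_rcons.
apply/allP => z; rewrite mem_rcons inE mem_rev => zp2; apply: sub.
rewrite inE mem_cat mem_rcons inE; case/orP: zp2 => ->; rewrite ?orbT //.
Qed.

(** Every edge of the path contains a vertex of [q], and the edges of a simple path are distinct; so
    they can be coloured one by one without touching sets that avoid [q]. *)
Lemma recolor_path r c a x q :
  uniq (x :: q) -> path r x q ->
  exists c', (forall A : {set T}, ~~ has [in A] q -> c' A = c A) /\
    apath r c' a x q.
Proof.
elim: q c a x => [|y q IHq] c a x; first by exists c.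
rewrite cons_uniq inE negb_or => /andP[/andP[xy xq] uq] /andP[rxy rq].
pose c1 A := if A == [set x; y] then a else c A.
have [c' [Dc' aq]] := IHq c1 (~~ a) y uq rq.
exists c'; split.
  move=> A /= /norP[Ay Aq]; rewrite Dc' // /c1 ifN //.
  by apply: contraNneq Ay => ->; rewrite !inE eqxx orbT.
rewrite /= rxy aq andbT Dc' /c1 ?eqxx //.
apply/hasPn => z qz; rewrite !inE negb_or; apply/andP; split.
  by apply: contraNneq xq => <-.
by move: uq; rewrite cons_uniq => /andP[yq _]; apply: contraNneq yq => <-.
Qed.

Lemma set2_neq x y z w : w != x -> w != y -> [set x; y] != [set z; w].
Proof.
move=> wx wy; apply/eqP => E.
have : w \in [set x; y] by rewrite E !inE eqxx orbT.
by rewrite !inE (negPf wx) (negPf wy).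
Qed.

(** The ear [q] leads from [u'] back to [u] outside [S] and closes a cycle with [p], of length
    [size p + size q + 1], which is even. The last hypothesis excludes running back and forth along
    a single edge. *)
Lemma ear_cycle r c S a u u' p q :
  symmetric r -> u \in S -> alink r c S a u u' p ->
  q != [::] -> uniq q -> ~~ has [in S] q -> path r u' (rcons q u) ->
  odd (size p + size q) -> (u != u') || (1 < size q) ->
  exists c', (forall A : {set T}, A \subset S -> c' A = c A) /\
    strong r c' [set z in u :: p ++ q].
Proof.
move=> r_sym Su lp q0 uq Sq rq opq nd.
have /and4P[ap up /eqP Du' Sp] := lp.
have Su' : u' \in S.
  by rewrite -Du'; case: (p) Sp => //= y p' /andP[Sy /allP Sp]; have :=
    mem_last y p';
     rewrite inE => /orP[/eqP->|/Sp].
have nSq z : z \in q -> z \notin S by apply: (hasPn Sq).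
have u'q : u' \notin q by apply: contraL Su' => /nSq.
have u_q : u \notin q by apply: contraL Su => /nSq.
move: (rq); rewrite rcons_path => /andP[rq1 rl].
have uq' : uniq (u' :: q) by rewrite /= u'q.
have [c1 [Dc1 aq]] := recolor_path c (a (+) odd (size p)) uq' rq1.
pose l := last u' q; have lq : l \in q.
  by rewrite /l; case: (q) q0 => // y q' _; rewrite /= mem_last.
(* The closing edge must differ from the first edge after [u], which has colour [a] (it is an ear
   edge when [p] is empty). *)
pose c' A := if A == [set l; u] then ~~ a else c1 A.
have Dc' (A : {set T}) : A \subset S -> c' A = c A.
  move=> AS; have Al : ~~ has [in A] q.
    by apply/hasPn => z /nSq; apply: contra; apply: (subsetP AS).
  rewrite /c' ifN ?Dc1 //; apply: contraNneq Al => ->.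
  by apply/hasP; exists l; rewrite // !inE eqxx.
exists c'; split=> //.
have aq' : apath r c' (a (+) odd (size p)) u' q.
  case: (q) q0 (aq) lq u_q uq nd (erefl l : l = last u' q) => //= y q2 _.
  move=> /and3P[-> /eqP <- aq2] lq u_q /andP[yq2 uq2] nd Dl; rewrite /c'.
  rewrite ifN ?eqxx /=; last first.
    apply/eqP => E; have : u \in [set u'; y] by rewrite E !inE eqxx orbT.
    have := u_q; rewrite !inE negb_or => /andP[/negPf-> _]; rewrite orbF =>
      /eqP Duu'.
    move: nd; rewrite -Duu' eqxx /= ltnS => q2_gt0.
    have : l \in [set u; y] by rewrite Duu' E !inE eqxx.
    rewrite !inE => /orP[/eqP lu|/eqP ly].
      by rewrite lu (negPf u_q) in lq.
    by move: yq2; rewrite -ly Dl; case: (q2) q2_gt0 => //= z q3 _;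
      rewrite mem_last.
  rewrite -(@apath_congr r r c1 c' [set z in y :: q2]) ?inE ?eqxx //.
    move=> v w; rewrite !in_set => qv qw; split=> //; rewrite /c' ifN //.
    by apply: set2_neq; apply: contraNneq u_q => ->.
  by apply/allP => z qz; rewrite !inE qz orbT.
apply: (@alternating_cycle_strong _ _ a) => //.
- rewrite -cat_cons cat_uniq up uq andbT has_sym.
  apply/hasPn => z; rewrite inE => /orP[/eqP->|pz] //.
  by apply: contraL (allP Sp z pz) => /nSq.
- rewrite rcons_cat apath_cat Du' -cats1 apath_cat aq' -/l /= rl.
  rewrite -(@apath_congr r r c c' S) ?ap //; last first.
    by move=> v w Sv Sw; rewrite Dc' // subUset !sub1set Sv.
  rewrite /c' eqxx /= andbT; move: opq; rewrite oddD.
  by case: (a) (odd _) (odd _) => [] [] [].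
by rewrite size_cat.
Qed.

(** Colour [v u] and [v u'] so that the path [p] continues alternately to [v] past both of its ends.
    The cycle so formed may be odd and need not be strong, but each of its other vertices reaches
    [v] with either start colour, which is all that [alink_enter] asks. *)
Lemma pconn_add r c S v u u' :
  symmetric r -> pconn r c S -> v \notin S -> u \in S -> u' \in S -> u != u' ->
  r v u -> r v u' ->
  exists c', (forall A : {set T}, v \notin A -> c' A = c A) /\
    pconn r c' (v |: S).
Proof.
move=> r_sym pS nSv Su Su' uu' rvu rvu'.
have [a [p /and4P[ap up /eqP Du' Sp]]] := pS u u' Su Su' uu'.
pose c' A := if A == [set v; u] then ~~ a
  else if A == [set v; u'] then a (+) odd (size p) else c A.
have Dc' (A : {set T}) : v \notin A -> c' A = c A.
  move=> Av; rewrite /c' !ifN //; apply: contraNneq Av => ->;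
    rewrite !inE eqxx //.
exists c'; split=> //.
have cu : c' [set v; u] = ~~ a by rewrite /c' eqxx.
have cu' : c' [set v; u'] = a (+) odd (size p).
  rewrite /c' eqxx ifN // set2_neq //.
  by apply: contraNneq nSv => <-.
have pS' : pconn r c' S.
  apply: pconn_congr pS => A AS; apply: Dc'.
  by apply: contra nSv; apply: (subsetP AS).
have vNS z : z \in S -> z != v by apply: contraTneq => ->.
have ap' : apath r c' a u p.
  rewrite -(@apath_congr r r c c' S) ?ap // => x y Sx Sy.
  by rewrite Dc' // !inE negb_or ![v == _]eq_sym !vNS.
have vp : v \notin p by apply: contra nSv => /(allP Sp).
pose Y := v |: [set z in u :: p].
have toY w b : w \in Y -> w != v -> exists q, alink r c' Y b w v q.
  rewrite !inE => /orP[->//|wp] wv.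
  have [p1 [p2 [Dp Dw]]] : exists p1 p2, p = p1 ++ p2 /\ last u p1 = w.
    case/orP: wp => [/eqP->|]; first by exists [::], p.
    by case/path.splitP=> p1 p2; exists (rcons p1 w), p2; rewrite last_rcons.
  move: ap'; rewrite Dp apath_cat Dw => /andP[ap1 ap2].
  (* The colour [b] decides the direction: forward along [p] through [u'], or back through [u]. *)
  have [Db|Db] := boolP (b == a (+) odd (size p1)).
    exists (rcons p2 v); rewrite (eqP Db); apply/and4P; split.
    - have lu' : last w p2 = u' by rewrite -Dw -last_cat -Dp.
      rewrite -cats1 apath_cat ap2 /= lu' r_sym rvu' setUC cu' andbT.
      by rewrite -addbA -oddD -size_cat -Dp eqxx.
    - move: up; rewrite Dp -cat_cons lastI Dw cat_rcons cat_uniq -rcons_cons.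
      rewrite rcons_uniq => /and3P[_ _ ->];
        rewrite andbT inE negb_or eq_sym wv /=.
      by apply: contra vp; rewrite Dp mem_cat => ->; rewrite orbT.
    - by rewrite last_rcons.
    apply/allP => z; rewrite /Y mem_rcons !inE Dp mem_cat.
    by case/orP=> ->; rewrite ?orbT.
  exists (rev (belast u p1) ++ [:: v]).
  have := @alink_vee r c' Y a u p1 [:: v] r_sym ap1.
  rewrite Dw; have -> : ~~ (a (+) odd (size p1)) = b by move: Db;
    case: (b) (_ (+) _) => [] [].
  apply.
  - by rewrite /= r_sym rvu setUC cu eqxx.
  - rewrite -cat_cons cats1 rcons_uniq; move: up; rewrite Dp -cat_cons cat_uniq.
    case/andP=> -> _; rewrite andbT inE negb_or eq_sym vNS //=.
    by apply: contra vp; rewrite Dp mem_cat => ->.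
  apply/allP => z; rewrite /Y !inE mem_cat inE Dp mem_cat.
  by case/or3P=> ->; rewrite ?orbT.
have SY : v |: S = S :|: Y.
  apply/eqP; rewrite eqEsubset !subUset !sub1set !inE eqxx orbT /= subsetUl.
  rewrite subsetUr /=; apply/subsetP=> z; rewrite !inE.
  by case/orP=> [/eqP->|/(allP Sp)->]; rewrite ?Su orbT.
have Yu : u \in Y by rewrite !inE eqxx orbT.
have to_v x : x \in S -> exists a p, alink r c' (v |: S) a x v p.
  move=> Sx; rewrite SY; have [Yx|nYx] := boolP (x \in Y).
    have [q lq] := toY x true Yx (vNS x Sx).
    by exists true, q; apply: alink_sub lq; apply: subsetUr.
  have xu : x != u by apply: contraNneq nYx => ->.
  have [b [q lq]] := pS' x u Sx Su xu; exists b.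
  by apply: alink_enter lq _ _ _ _; rewrite // !inE eqxx.
move=> x y; rewrite !inE => /orP[/eqP->|Sx] /orP[/eqP->|Sy] xy.
- by rewrite eqxx in xy.
- have [b [q lq]] := to_v y Sy.
  have [|b' [q' [lq' _]]] := alink_sym r_sym _ lq;
    first by rewrite !inE Sy orbT.
  by exists b', q'.
- exact: to_v.
have [b [q lq]] := pS' x y Sx Sy xy.
by exists b, q; apply: alink_sub lq; apply: subsetUr.
Qed.

End Alternating.

(** * Ears, tripods and maximal sets *)

Section Ears.
Variable T : finType.
Implicit Types (c : {set T} -> bool) (r : rel T) (S : {set T}).
Implicit Types (u : T) (p q : seq T).

Lemma setU_ear S u p q :
  u \in S -> all [in S] p ->
  S :|: [set z in u :: p ++ q] = S :|: [set z in q].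
Proof.
move=> Su Sp; apply/setP=> z; rewrite !inE mem_cat.
have [//|nSz] /= := boolP (z \in S).
rewrite (negPf (contra (allP Sp z) nSz)) /=.
by have [zu|//] := eqVneq z u; rewrite zu Su in nSz.
Qed.

(** The even cycle formed by the ear and [p] is strong and shares [u] with [S], so [strongU]
    applies. *)
Lemma strong_ear r c S a u u' p q :
  symmetric r -> u \in S -> alink r c S a u u' p ->
  q != [::] -> uniq q -> ~~ has [in S] q -> path r u' (rcons q u) ->
  odd (size p + size q) -> (u != u') || (1 < size q) ->
  strong r c S ->
  exists c', (forall A : {set T}, A \subset S -> c' A = c A) /\
    strong r c' (S :|: [set z in q]).
Proof.
move=> r_sym Su lp q0 uq Sq rq opq nd sS.
have [c' [Dc' sC]] := ear_cycle r_sym Su lp q0 uq Sq rq opq nd.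
exists c'; split=> //; have /and4P[_ _ _ Sp] := lp.
rewrite -(setU_ear q Su Sp); apply: (@strongU _ _ _ _ _ u) => //.
  by apply: strong_congr sS => v w Sv Sw; rewrite Dc' // subUset !sub1set Sv.
by rewrite !inE eqxx.
Qed.

Lemma pconn_ear r c S a u u' p q :
  symmetric r -> u \in S -> alink r c S a u u' p ->
  q != [::] -> uniq q -> ~~ has [in S] q -> path r u' (rcons q u) ->
  odd (size p + size q) -> (u != u') || (1 < size q) ->
  pconn r c S ->
  exists c', (forall A : {set T}, A \subset S -> c' A = c A) /\
    pconn r c' (S :|: [set z in q]).
Proof.
move=> r_sym Su lp q0 uq Sq rq opq nd sS.
have [c' [Dc' sC]] := ear_cycle r_sym Su lp q0 uq Sq rq opq nd.
exists c'; split=> //; have /and4P[_ _ _ Sp] := lp.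
rewrite -(setU_ear q Su Sp); apply: (@pconnU _ _ _ _ _ u) => //.
  exact: pconn_congr sS.
by rewrite !inE eqxx.
Qed.

(** Take a path from [d1] to [d2] and follow a path from [d3] until it first meets that path, at
    [x]. *)
Lemma tripod r d1 d2 d3 :
  symmetric r -> connect r d1 d2 -> connect r d1 d3 ->
  exists x l1 l2 l3,
   [/\ [/\ path r x l1, path r x l2 & path r x l3],
       [/\ last x l1 = d1, last x l2 = d2 & last x l3 = d3] &
       [/\ uniq (x :: l1 ++ l2), uniq (x :: l1 ++ l3) & uniq (x :: l2 ++ l3)]].
Proof.
move=> r_sym /connect_uniq_path[p [rp up lp]].
rewrite (sym_connect_sym r_sym) => /connect_uniq_path[m [rm um lm]].
have [|m1 [m2 [Dm hit nhit]]] := @first_hit _ [in d1 :: p] d3 m.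
  by rewrite lm /= mem_head.
move: rm um; rewrite Dm cat_path -cat_cons cat_uniq =>
  /andP[rm1 _] /andP[um1 _].
set x := last d3 m1 in hit.
have [p1 [p2 [Dp Dx]]] : exists p1 p2, p = p1 ++ p2 /\ last d1 p1 = x.
  move: hit; rewrite !inE => /orP[/eqP->|]; first by exists [::], p.
  by case/path.splitP=> p1 p2; exists (rcons p1 x), p2; rewrite last_rcons.
move: rp; rewrite Dp cat_path => /andP[rp1]; rewrite Dx => rp2.
have pE1 : perm_eq (x :: rev (belast d1 p1)) (d1 :: p1).
  by rewrite -Dx rev_belast_cons perm_rev.
have uE : uniq (x :: rev (belast d1 p1) ++ p2).
  by rewrite -cat_cons (perm_uniq (perm_cat pE1 (perm_refl p2))) cat_cons -Dp.
have sub12 z : z \in x :: rev (belast d1 p1) ++ p2 -> z \in d1 :: p.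
  by rewrite -cat_cons (perm_mem (perm_cat pE1 (perm_refl p2))) cat_cons -Dp.
have um1' : uniq (belast d3 m1) by move: um1; rewrite lastI rcons_uniq =>
  /andP[].
have dis l : {subset l <= x :: rev (belast d1 p1) ++ p2} -> uniq l ->
    uniq (l ++ rev (belast d3 m1)).
  move=> sl ul; rewrite cat_uniq ul rev_uniq um1' andbT.
  apply: contra nhit => /hasP[z]; rewrite mem_rev => mz /sl /sub12 zp.
  by apply/hasP; exists z.
exists x, (rev (belast d1 p1)), p2, (rev (belast d3 m1)); split; split=> //.
- by rewrite -Dx path_rev_belast.
- by rewrite path_rev_belast.
- by rewrite -Dx last_rev_belast.
- by rewrite -Dx -last_cat -Dp.
- by rewrite last_rev_belast.
- rewrite -cat_cons; apply: dis.
    by move=> z; rewrite !inE mem_cat => /orP[]->; rewrite ?orbT.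
  by move: uE; rewrite -cat_cons cat_uniq => /andP[].
- rewrite -cat_cons; apply: dis.
    by move=> z; rewrite !inE mem_cat => /orP[]->; rewrite ?orbT.
  by apply: subseq_uniq uE; rewrite /= eqxx suffix_subseq.
Qed.

(** Induction on the number of vertices outside [X]; [P] is an arbitrary proposition, whence the
    classical case split. *)
Lemma maximal_set (P : {set T} -> Prop) (X : {set T}) :
  P X ->
  exists Y : {set T}, [/\ X \subset Y, P Y & forall Z : {set T}, Y \subset Z ->
    P Z -> Z \subset Y].
Proof.
have [n] := ubnP (#|T| - #|X|); elim: n X => // n IHn X le_n PX.
have [[Z [XZ PZ]]|maxX] := classic (exists Z : {set T}, X \proper Z /\ P Z);
  last first.
  exists X; split=> // Z XZ PZ; have [//|nZX] := boolP (Z \subset X).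
  by case: maxX; exists Z; rewrite properE XZ.
have lt_c : #|T| - #|Z| < n.
  apply: leq_trans (ltn_sub2l _ (proper_card XZ)) le_n.
  exact: leq_trans (proper_card XZ) (max_card _).
have [Y [ZY PY maxY]] := IHn Z lt_c PZ; exists Y; split=> //.
by apply: subset_trans (proper_sub XZ) ZY.
Qed.

End Ears.

(** * Maximal bipartite strong sets *)

Section Bipartite.
Variables (T : finType) (e : rel T).
Hypothesis e_sym : symmetric e.
Implicit Types (c : {set T} -> bool) (s : T -> bool) (H : {set T}).
Implicit Types (x y u v d : T) (p q l : seq T).

Definition bip s : rel T := [rel x y | e x y && (s x != s y)].

Lemma bip_sym s : symmetric (bip s).
Proof. by move=> x y; rewrite /bip /= e_sym eq_sym. Qed.

Lemma strong_bip s c H : strong (bip s) c H -> strong e c H.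
Proof.
move=> sH x y a Hx Hy xy; have [p /and4P[ap up lp Hp]] := sH x y a Hx Hy xy.
exists p; apply/and4P; split=> //.
by apply: apath_subrel ap => z w /andP[].
Qed.

Lemma bip_parity s x p : path (bip s) x p ->
  s (last x p) = s x (+) odd (size p).
Proof.
elim: p x => [|y p IHp] x /=; first by rewrite addbF.
case/andP=> /andP[_ sxy] /IHp ->; move: sxy.
by case: (s x) (s y) (odd _) => [] [] [].
Qed.

Lemma recolor_sides s x q :
  uniq (x :: q) -> path e x q ->
  exists s', (forall v, v \notin q -> s' v = s v) /\ path (bip s') x q.
Proof.
elim: q s x => [|y q IHq] s x; first by exists s.
rewrite cons_uniq inE negb_or => /andP[/andP[xy xq] uq] /andP[exy eq].
pose s1 v := if v == y then ~~ s x else s v.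
have [s' [Ds' sq]] := IHq s1 y uq eq.
exists s'; split.
  by move=> v; rewrite inE negb_or => /andP[vy vq];
    rewrite Ds' // /s1 (negPf vy).
move: uq; rewrite cons_uniq => /andP[yq _].
rewrite /= sq /bip /= exy !Ds' // /s1 (negPf xy) eqxx andbT.
by case: (s x).
Qed.

(** The parity condition says that the [size q + 1] edges of the ear fit the sides of its ends, so
    its inner vertices can be put on alternate sides. All cycles of [bip s'] are even, hence
    [strong_ear] applies with a path of [H] from [u] to [u']. *)
Lemma bip_ear s c H u u' q :
  strong (bip s) c H -> u \in H -> u' \in H ->
  q != [::] -> uniq q -> ~~ has [in H] q -> path e u' (rcons q u) ->
  odd (size q) != s u (+) s u' -> (u != u') || (1 < size q) ->
  exists s' c', strong (bip s') c' (H :|: [set z in q]).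
Proof.
move=> sH Hu Hu' q0 uq Hq eq odq nd.
have nHq z : z \in q -> z \notin H by apply: (hasPn Hq).
move: (eq); rewrite rcons_path => /andP[eq1 el].
have [|s' [Ds' sq]] := @recolor_sides s u' q _ eq1.
  by rewrite /= uq andbT; apply: contraL Hu' => /nHq.
have sHs : {in H, s' =1 s}.
  by move=> v Hv; apply: Ds'; apply: contraL Hv => /nHq.
have sH' : strong (bip s') c H.
  by apply: strong_congr sH => v w Hv Hw; rewrite /bip /= !sHs.
have bq : path (bip s') u' (rcons q u).
  rewrite rcons_path sq /bip /= el (bip_parity sq) !sHs //.
  by move: odq; case: (odd _) (s u) (s u') => [] [] [].
have [p [a lp]] : exists p a, alink (bip s') c H a u u' p.
  have [<-|uu'] := eqVneq u u'.
    by exists [::], true; rewrite /alink /= eqxx.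
  by have [p lp] := sH' u u' true Hu Hu' uu'; exists p, true.
have /and4P[/apath_path/bip_parity bp _ /eqP lpu _] := lp.
have [|c' [_ sc']] := strong_ear (@bip_sym s') Hu lp q0 uq Hq bq _ nd sH'.
  move: bp; rewrite lpu !sHs // oddD; move: odq.
  by case: (odd _) (odd _) (s u) (s u') => [] [] [] [].
by exists s', c'.
Qed.

(** Sides and colouring vary with [H'], since adding an ear assigns both anew off [H]. *)
Definition bip_maximal s c H := strong (bip s) c H /\
  forall s' c' (H' : {set T}), H \subset H' -> strong (bip s') c' H' ->
    H' \subset H.

Lemma delete_path H x p :
  path (delete_vertices e H) x p -> path e x p /\ ~~ has [in H] p.
Proof.
elim: p x => //= y p IHp x /andP[/and3P[_ Hy exy] /IHp[ep Hp]].
by rewrite exy negb_or Hy.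
Qed.

Lemma delete_sym H : symmetric (delete_vertices e H).
Proof. by move=> x y; rewrite /delete_vertices /= e_sym andbCA. Qed.

Section Maximal.
Variables (s : T -> bool) (c : {set T} -> bool) (H : {set T}).
Hypothesis Hmax : bip_maximal s c H.
Let rW := delete_vertices e H.

(** Otherwise the ear with inner vertices [y :: q] would fit the bipartition, and [bip_ear] would
    enlarge [H]. *)
Lemma odd_ear u u' y q :
  u \in H -> u' \in H -> y \notin H -> path rW y q -> uniq (y :: q) ->
  e y u -> e (last y q) u' -> (u != u') || (y != last y q) ->
  ~~ odd (size q) = s u (+) s u'.
Proof.
move=> Hu Hu' Hy /delete_path[eq Hq] uq eyu elu' nd.
have [//|odq] := eqVneq (~~ odd (size q)) (s u (+) s u').
have [||||||s' [c' sH']] := @bip_ear s c H u' u (y :: q) Hmax.1 Hu' Hu => //.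
- by rewrite /= negb_or Hy.
- by rewrite /= e_sym eyu rcons_path eq.
- by rewrite /= addbC.
- rewrite eq_sym; case/orP: nd => [->//|]; case: (q) => [|z q'] /=;
    first by rewrite eqxx.
  by rewrite orbT.
have := Hmax.2 _ _ _ (subsetUl _ _) sH'.
by rewrite subUset => /andP[_ /subsetP/(_ y)]; rewrite !inE eqxx (negPf Hy) =>
  /(_ isT).
Qed.

Lemma odd_legs u u' x l l' :
  u \in H -> u' \in H -> last x l \notin H -> path rW x l -> path rW x l' ->
  uniq (x :: l ++ l') -> e (last x l) u -> e (last x l') u' ->
  (u != u') || (last x l != last x l') ->
  ~~ odd (size l + size l') = s u (+) s u'.
Proof.
move=> Hu Hu' Hl rl rl' ul elu elu' nd.
rewrite -(@odd_ear u u' (last x l) (rev (belast x l) ++ l')) //.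
- by rewrite size_cat size_rev size_belast.
- by rewrite cat_path path_rev_belast ?rl ?last_rev_belast //;
    apply: delete_sym.
- rewrite -cat_cons rev_belast_cons cat_uniq rev_uniq has_sym (eq_has_r (mem_rev _)).
  by rewrite has_sym -cat_uniq.
- by rewrite last_cat last_rev_belast.
by rewrite last_cat last_rev_belast.
Qed.

(** The legs of a tripod give three parity equations by [odd_legs]. In their sum modulo 2 every leg
    length and every side occurs twice, while the three negations leave 1. *)
Lemma no_three_boundary_edges u1 u2 u3 d1 d2 d3 :
  u1 \in H -> u2 \in H -> u3 \in H -> d1 \notin H -> d2 \notin H ->
  e d1 u1 -> e d2 u2 -> e d3 u3 -> connect rW d1 d2 -> connect rW d1 d3 ->
  (u1 != u2) || (d1 != d2) -> (u1 != u3) || (d1 != d3) ->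
  (u2 != u3) || (d2 != d3) -> False.
Proof.
move=> H1 H2 H3 N1 N2 e1 e2 e3 c12 c13 n12 n13 n23.
have [x [l1 [l2 [l3 [[r1 r2 r3] [L1 L2 L3] [U12 U13 U23]]]]]] :=
  tripod (@delete_sym H) c12 c13.
have := odd_legs (u := u1) (u' := u2) H1 H2 _ r1 r2 U12.
have := odd_legs (u := u1) (u' := u3) H1 H3 _ r1 r3 U13.
have := odd_legs (u := u2) (u' := u3) H2 H3 _ r2 r3 U23.
rewrite L1 L2 L3 =>
  /(_ N2 e2 e3 n23) P23 /(_ N1 e1 e3 n13) P13 /(_ N1 e1 e2 n12).
move: P23 P13; rewrite !oddD.
by case: (odd _) (odd _) (odd _) (s u1) (s u2) (s u3) => [] [] [] [] [] [].
Qed.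

End Maximal.
End Bipartite.

(** * Cycles and boundary edges in a 2-connected graph *)

Section Graph.
Variables (T : finType) (e : rel T).
Hypotheses (e_sym : symmetric e) (e_irr : irreflexive e).
Hypothesis e_2conn : k_connected e 2.
Implicit Types (c : {set T} -> bool) (s : T -> bool) (H S : {set T}).
Implicit Types (x y z u v w d : T) (p q : seq T).

Lemma path_avoiding v x y :
  x != v -> y != v ->
  exists p, [/\ path e x p, uniq (x :: p), last x p = y & v \notin p].
Proof.
move=> xv yv; have [_ /(_ [set v])] := e_2conn.
rewrite cards1 => /(_ isT x y); rewrite !inE => /(_ xv yv).
case/connect_uniq_path=> p [/delete_path[ep Hp] up lp]; exists p; split=> //.
by apply: contra Hp => vp; apply/hasP; exists v; rewrite ?inE.
Qed.

Lemma delete_edge H x y :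
  x \notin H -> y \notin H -> e x y -> connect (delete_vertices e H) x y.
Proof. by move=> Hx Hy exy; apply: connect1;
  rewrite /delete_vertices /= Hx Hy. Qed.

Lemma delete_connectN H x y :
  connect (delete_vertices e H) x y -> x \notin H -> y \notin H.
Proof.
case/connectP=> p; elim: p x => [|z p IHp] x /=; first by move=> _ ->.
by case/andP=> /and3P[_ Hz _] rp Dy _; apply: IHp rp Dy Hz.
Qed.

Lemma first_exit H d p :
  path e d p -> d \notin H -> last d p \in H ->
  exists d' u, [/\ connect (delete_vertices e H) d d', d' \notin H, u \in H,
    e d' u & d' \in d :: p /\ u \in p].
Proof.
elim: p d => [|y p IHp] d /=; first by move=> _ /negPf->.
case/andP=> edy ep Hd Hl; have [Hy|Hy] := boolP (y \in H).
  by exists d, y; split=> //; rewrite !inE !eqxx.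
have [d' [u [cd Hd' Hu eu [pd' pu]]]] := IHp y ep Hy Hl.
exists d', u; split=> //; first exact: connect_trans (delete_edge Hd Hy edy) cd.
by rewrite inE pd' inE pu !orbT.
Qed.

(** Deleting [u] leaves a path from [d] to [u0]; take the edge by which it first enters [H]. *)
Lemma boundary_avoiding_outer H d u u0 :
  d \notin H -> u \in H -> u0 \in H -> u0 != u ->
  exists d' u', [/\ connect (delete_vertices e H) d d', d' \notin H, u' \in H,
    e d' u' & u' != u].
Proof.
move=> Hd Hu Hu0 u0u; have du : d != u by apply: contraNneq Hd => ->.
have [p [ep _ lp pu]] := path_avoiding du u0u.
have [|d' [u' [cd Hd' Hu' eu' [_ pu']]]] := first_exit ep Hd;
  first by rewrite lp.
by exists d', u'; split=> //; apply: contraNneq pu => <-.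
Qed.

Lemma boundary_avoiding_inner H x d u0 :
  x \notin H -> d \notin H -> x != d -> u0 \in H ->
  exists d' u', [/\ connect (delete_vertices e H) x d', d' \notin H, u' \in H,
    e d' u' & d' != d].
Proof.
move=> Hx Hd xd Hu0; have u0d : u0 != d by apply: contraTneq Hu0 => ->.
have [p [ep _ lp pd]] := path_avoiding xd u0d.
have [|d' [u' [cd Hd' Hu' eu' [pd' _]]]] := first_exit ep Hx;
  first by rewrite lp.
exists d', u'; split=> //; apply: contraTneq pd' => ->.
by rewrite inE negb_or eq_sym xd.
Qed.

(** Take an edge [x y], a second neighbour [w] of [y], and a path from [w] to [x] avoiding [y]. *)
Lemma exists_cycle :
  exists x q, [/\ uniq (x :: q), path e x (rcons q x) & 1 < size q].
Proof.
have [T_gt2 _] := e_2conn.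
have other x y : exists z, z != x /\ z != y.
  have /card_gt0P[z] : 0 < #|~: [set x; y]|.
    rewrite cardsCs setCK subn_gt0; apply: leq_ltn_trans T_gt2.
    by rewrite cards2; case: (_ == _).
  by rewrite !inE negb_or => /andP[zx zy]; exists z.
have /card_gt0P[x _] : 0 < #|T| by apply: leq_trans T_gt2.
have [z [zx _]] := other x x; have [v [vx vz]] := other x z.
have xv : x != v by rewrite eq_sym.
have zv : z != v by rewrite eq_sym.
have [[|y p] [/= ep _ lp _]] := path_avoiding xv zv;
  first by rewrite -lp eqxx in zx.
case/andP: ep => exy _.
have yx : y != x by apply: contraTneq exy => ->; rewrite e_irr.
have [w0 [w0x w0y]] := other x y.
have [[|w p'] [/= ep' _ lp' xp']] := path_avoiding yx w0x.
  by rewrite -lp' eqxx in w0y.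
case/andP: ep' => eyw _.
have wx : w != x by apply: contraNneq xp' => ->; rewrite inE eqxx.
have wy : w != y by apply: contraTneq eyw => ->; rewrite e_irr.
have xy : x != y by rewrite eq_sym.
have [m [em um lm my]] := path_avoiding wy xy.
case/lastP: m => [|m x'] in em um lm my *; first by rewrite -lm /= eqxx in wx.
rewrite last_rcons in lm; rewrite {x'}lm in em um my.
exists x, (y :: w :: m); split=> //; last by rewrite /= exy eyw.
move: um my; rewrite -rcons_cons rcons_uniq mem_rcons inE negb_or =>
  /andP[xm um].
case/andP=> yx' ym; rewrite cons_uniq inE negb_or xy xm /=.
by rewrite inE negb_or eq_sym wy ym.
Qed.

(** The cycle runs along [p1] and back along [p2]; the last hypothesis excludes that both are the
    single edge [h h']. *)
Lemma even_cycle_of_two_paths h h' p1 p2 :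
  path e h (rcons p1 h') -> path e h (rcons p2 h') ->
  uniq (h :: h' :: p1 ++ p2) -> ~~ odd (size p1 + size p2) ->
  0 < size (p1 ++ p2) ->
  exists x q, [/\ uniq (x :: q), path e x (rcons q x), odd (size q) & 1 < size q].
Proof.
move=> ep1 ep2 up op p_gt0; exists h, (rcons p1 h' ++ rev p2); split.
- have pE : perm_eq (h :: rcons p1 h' ++ rev p2) (h :: h' :: p1 ++ p2).
    rewrite perm_cons -cat_cons perm_cat ?perm_rcons //.
    by rewrite perm_rev.
  by rewrite (perm_uniq pE).
- rewrite rcons_cat cat_path ep1 last_rcons /=.
  have := path_rev_belast h (rcons p2 h') e_sym.
  by rewrite last_rcons belast_rcons rev_cons ep2.
- by rewrite size_cat size_rcons size_rev addSn.
by rewrite size_cat size_rcons size_rev addSn -size_cat ltnS.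
Qed.

(** If an odd cycle misses a vertex, 2-connectivity gives an ear with two distinct ends on it. The
    two arcs between these ends have lengths of different parity, so one of them closes an even
    cycle with the ear. *)
Lemma even_cycle_or_hamiltonian :
  (exists x q, [/\ uniq (x :: q), path e x (rcons q x), odd (size q) & 1 < size q])
  \/ (exists x q, [/\ uniq (x :: q), path e x q & forall y, y \in x :: q]).
Proof.
have [x [q [uq eq q_gt1]]] := exists_cycle.
have [hq|/forallPn[y yq]] := boolP [forall y, y \in x :: q].
  right; exists x, q; split=> //; last exact/forallP.
  by move: eq; rewrite rcons_path => /andP[].
left; have [oq|oq] := boolP (odd (size q)); first by exists x, q.
pose H := [set z in x :: q].
have [z qz] : exists z, z \in q by case: (q) q_gt1 => // z q' _; exists z;
  rewrite inE eqxx.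
have Hx : x \in H by rewrite !inE eqxx.
have Hz : z \in H by rewrite !inE qz orbT.
have zx : z != x by apply: contraTneq qz => ->; move: uq; rewrite cons_uniq =>
  /andP[].
have Hy : y \notin H by rewrite in_set.
have [d [h [_ Hd Hh edh _]]] := boundary_avoiding_outer Hy Hx Hz zx.
have [h0 Hh0 h0h] : exists2 h0, h0 \in H & h0 != h.
  have [hx|hx] := eqVneq x h; first by exists z; rewrite // -hx.
  by exists x.
have [d' [h' [cd Hd' Hh' ed'h' h'h]]] := boundary_avoiding_outer Hd Hh Hh0 h0h.
have [p [/delete_path[ep Hp] up lp]] := connect_uniq_path cd.
have [i q' Dq'] : rot_to_spec (x :: q) h by apply: rot_to; rewrite in_set in Hh.
have memq' w : (w \in h :: q') = (w \in H) by rewrite -Dq' mem_rot in_set.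
have uq' : uniq (h :: q') by rewrite -Dq' rot_uniq.
have eq' : path e h (rcons q' h).
  by rewrite -[path _ _ _]/(cycle e (h :: q')) -Dq' rot_cycle.
have sq' : ~~ odd (size q').
  by have := congr1 size Dq'; rewrite size_rot /= => -[<-].
move: Hh'; rewrite -memq' inE (negPf h'h) /= => qh'.
case/path.splitP: qh' => q1 q2 in uq' memq' sq' eq' *.
have Hdp w : w \in d :: p -> w \notin h :: rcons q1 h' ++ q2.
  by rewrite memq' inE => /orP[/eqP->//|]; apply: (hasPn Hp).
have perm_q l : perm_eq (h :: h' :: q1 ++ l) (h :: rcons q1 h' ++ l).
  by rewrite perm_cons -cat_cons perm_cat // perm_sym perm_rcons.
move: (eq'); rewrite rcons_cat cat_path last_rcons => /andP[eq1 eq2].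
have eq2' : path e h (rcons (rev q2) h').
  have := path_rev_belast h' (rcons q2 h) e_sym.
  by rewrite last_rcons belast_rcons rev_cons eq2.
have edp : path e h (rcons (d :: p) h').
  by rewrite rcons_path /= lp ep ed'h' e_sym edh.
have disj l : {subset l <= h :: rcons q1 h' ++ q2} -> uniq l ->
  uniq (l ++ d :: p).
  move=> sl ul; rewrite cat_uniq ul up andbT; apply/hasPn => w /Hdp.
  by apply: contra => /sl.
have [op|op] := boolP (odd (size q1 + size (d :: p))); last first.
  apply: (even_cycle_of_two_paths eq1 edp) => //;
    last by rewrite size_cat addnS.
  rewrite -!cat_cons; apply: disj.
    by move=> w;
      rewrite -[h' :: q1]cats0 (perm_mem (perm_q [::])) cats0 !inE mem_cat =>
      /orP[]->; rewrite ?orbT.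
  by rewrite -(cats0 (h :: h' :: q1)) (perm_uniq (perm_q [::])) cats0;
    move: uq'; rewrite -cat_cons cat_uniq => /andP[].
apply: (even_cycle_of_two_paths eq2' edp) => //; last by rewrite size_cat addnS.
  rewrite -!cat_cons; apply: disj.
    move=> w; rewrite !inE mem_rev mem_cat mem_rcons inE.
    by case/or3P=> ->; rewrite ?orbT.
  move: uq';
    rewrite !cons_uniq inE !mem_rev rev_uniq mem_cat mem_rcons inE !negb_or.
  rewrite cat_uniq => /and3P[/andP[/andP[-> _] ->] _ /andP[q12 ->]];
    rewrite andbT /=.
  by rewrite andbT; apply: contra q12 => q2h'; apply/hasP; exists h';
    rewrite // mem_rcons mem_head.
move: sq' op; rewrite size_cat size_rcons size_rev !oddD /=.
by case: (odd _) (odd _) (odd _) => [] [] [].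
Qed.

End Graph.

(** * Diameter three *)

Section Diameter.
Variables (T : finType) (e : rel T).
Hypotheses (e_sym : symmetric e) (e_irr : irreflexive e).
Hypothesis e_2conn : k_connected e 2.
Hypothesis e_near :
  forall x y, exists p, [/\ path e x p, last x p = y & size p <= 3].
Implicit Types (c : {set T} -> bool) (s : T -> bool) (H S : {set T}).
Implicit Types (x y z u v w d : T) (p q : seq T).

Definition double_nbr S v :=
  exists u u', [/\ u != u', u \in S, u' \in S, e v u & e v u'].

(** The last two clauses concern the whole graph: [x] and [x'] have degree 2, so the edge [x x'] is
    an entire component of the graph without [S]. *)
Definition pendant_edge S x x' u u' :=
  [/\ [/\ x \notin S, x' \notin S, u \in S, u' \in S & u != u'],
      [/\ e x x', e x u & e x' u'],
      (forall w, e x w -> w = u \/ w = x') &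
      (forall w, e x' w -> w = u' \/ w = x)].

Lemma near_cases x y : x != y ->
  [\/ e x y, exists2 a, e x a & e a y | exists a b, [/\ e x a, e a b & e b y]].
Proof.
have [p [ep lp sp]] := e_near x y => xy.
case: p ep lp sp => [|a [|b [|d []]]] //=.
- by move=> _ xE; rewrite xE eqxx in xy.
- by rewrite andbT => exa <- _; apply: Or31.
- by rewrite andbT => /andP[exa eab] <- _; apply: Or32; exists a.
by rewrite andbT => /and3P[exa eab ebd] <- _; apply: Or33; exists a, b.
Qed.

Lemma pconn_apath r c a x p :
  symmetric r -> apath r c a x p -> uniq (x :: p) ->
  pconn r c [set z in x :: p].
Proof.
move=> r_sym; elim: p a x => [|z p IHp] a x ap up y w.
  by rewrite !inE => /eqP-> /eqP->; rewrite eqxx.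
have main w' : w' \in z :: p ->
    exists b q, alink r c [set v in x :: z :: p] b x w' q.
  move=> pw; case/path.splitP: pw ap up => p1 p2; rewrite apath_cat =>
    /andP[ap1 _].
  rewrite -cat_cons cat_uniq => /andP[up1 _].
  exists a, (rcons p1 w'); apply/and4P; split; rewrite ?last_rcons //.
  by apply/allP => v p1v; rewrite in_set inE mem_cat p1v orbT.
rewrite !in_set ![_ \in x :: _]inE => /orP[/eqP->|py] /orP[/eqP->|pw] yw.
- by rewrite eqxx in yw.
- exact: main.
- have [b [q lq]] := main y py.
  have [|b' [q' [lq' _]]] := alink_sym r_sym _ lq; first by rewrite !inE eqxx.
  by exists b', q'.
have /= /and3P[_ _ ap'] := ap; move: up; rewrite cons_uniq => /andP[_ up'].
have [||b [q lq]] := IHp _ _ ap' up' y w _ _ yw; try by rewrite in_set.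
exists b, q; apply: alink_sub lq; apply/subsetP=> v; rewrite !in_set => pv.
by rewrite inE pv orbT.
Qed.

(** The tail begins at [u] with colour [true]. Coming back along it, one continues into [S] with
    colour [false], which the strength of [S] permits. *)
Lemma pconn_pendant r c S u q :
  symmetric r -> strong r c S -> u \in S -> path r u q -> uniq q ->
  ~~ has [in S] q ->
  exists c', (exists a, apath r c' a u q) /\ pconn r c' (S :|: [set z in q]).
Proof.
move=> r_sym sS Su rq uq Sq; have nSq z : z \in q ->
  z \notin S by apply: (hasPn Sq).
have uq' : uniq (u :: q) by rewrite /= uq andbT; apply: contraL Su => /nSq.
have [c' [Dc' aq]] := recolor_path c true uq' rq.
have sS' : strong r c' S.
  apply: strong_congr sS => v w Sv Sw; rewrite Dc' //; apply/hasPn => z /nSq.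
  by apply: contra; rewrite !inE => /orP[]/eqP->.
exists c'; split; first by exists true.
have main x y : x \in S -> y \in q ->
    exists b p, alink r c' (S :|: [set z in q]) b y x p.
  move=> Sx qy; have [q1 [q2 Dq]] : exists q1 q2, q = rcons q1 y ++ q2.
    by case/path.splitP: qy => q1 q2; exists q1, q2.
  have [p /and4P[ap up /eqP lp Sp]] : exists p, alink r c' S (~~ true) u x p.
    have [->|ux] := eqVneq u x; last exact: sS'.
    by exists [::]; rewrite /alink /= eqxx.
  exists (~~ (true (+) odd (size (rcons q1 y)))), (rev (belast u (rcons q1 y)) ++ p).
  rewrite -{2}(last_rcons u q1 y) -lp; apply: alink_vee => //.
  - by move: aq; rewrite Dq apath_cat => /andP[].
  - rewrite -cat_cons cat_uniq; apply/and3P; split.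
    + by move: uq'; rewrite Dq -cat_cons cat_uniq => /andP[].
    + apply/hasPn => v pv /=; rewrite inE negb_or; apply/andP; split.
        by apply: contraTneq pv => ->; move: up; rewrite cons_uniq => /andP[].
      apply: contraL (allP Sp v pv) => q1v.
      by apply: nSq; rewrite Dq mem_cat q1v.
    + by move: up; rewrite cons_uniq => /andP[].
  apply/allP => v; rewrite !inE mem_cat => /or3P[/eqP->|q1v|pv].
  - by rewrite Su.
  - by rewrite Dq mem_cat q1v orbT.
  by rewrite (allP Sp v pv).
move=> x y; rewrite !inE => /orP[Sx|qx] /orP[Sy|qy] xy.
- have [p lp] := sS' x y true Sx Sy xy.
  by exists true, p; apply: alink_sub lp; apply: subsetUl.
- have [b [p lp]] := main x y Sx qy.
  have [|b' [p' [lp' _]]] := alink_sym r_sym _ lp;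
    first by rewrite !inE qy orbT.
  by exists b', p'.
- exact: main.
have [||b [p lp]] := pconn_apath r_sym aq uq' _ _ xy.
- by rewrite in_set inE qx orbT.
- by rewrite in_set inE qy orbT.
exists b, p; apply: alink_sub lp; apply/subsetP=> v; rewrite !inE.
by case/orP=> [/eqP->|->]; rewrite ?Su ?orbT.
Qed.

(** A vertex outside a maximal properly connected superset of [S] could be added by [pconn_add]. *)
Lemma pconn_fill c S :
  pconn e c S ->
  (forall v, v \notin S -> double_nbr S v) ->
  exists c', pconn e c' [set: T].
Proof.
move=> pS nbrs.
have [X [SX [c' pX] maxX]] :=
  @maximal_set _ (fun X => exists c, pconn e c X) S (ex_intro _ c pS).
suff -> : [set: T] = X by exists c'.
apply/esym/eqP; rewrite -subTset; apply/subsetP=> v _.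
have [//|Xv] := boolP (v \in X).
have [|u [u' [uu' Su Su' evu evu']]] := nbrs v; first by apply: contra Xv;
  apply: (subsetP SX).
have [c1 [_ pX1]] :=
  pconn_add e_sym pX Xv (subsetP SX _ Su) (subsetP SX _ Su') uu' evu evu'.
have := maxX _ (subsetUr _ _) (ex_intro _ c1 pX1).
by rewrite subUset sub1set (negPf Xv).
Qed.

(** * Components outside a maximal bipartite strong set *)

Section Maximal.
Variables (s : T -> bool) (c : {set T} -> bool) (H : {set T}).
Hypotheses (Hmax : bip_maximal e s c H) (H_gt2 : 2 < #|H|).
Let rW := delete_vertices e H.

Definition attached x d1 u1 d2 u2 :=
  [/\ d1 != d2 /\ u1 != u2, connect rW x d1 /\ connect rW x d2,
      [/\ d1 \notin H, u1 \in H & e d1 u1],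
      [/\ d2 \notin H, u2 \in H & e d2 u2] &
      forall y u, connect rW x y -> u \in H -> e y u ->
        (y = d1 /\ u = u1) \/ (y = d2 /\ u = u2)].

Lemma rW_sym : connect_sym rW.
Proof. exact: sym_connect_sym (delete_sym e_sym H). Qed.

Lemma other_in_H u : exists2 u0, u0 \in H & u0 != u.
Proof.
have : 0 < #|H :\ u|.
  move: H_gt2; rewrite (cardsD1 u H) -ltnS; case: (u \in H) => /=.
    by rewrite add1n !ltnS; apply: leq_trans.
  by rewrite add0n ltnS; apply: leq_trans.
by case/card_gt0P=> u0; rewrite !inE => /andP[]; exists u0.
Qed.

(** 2-connectivity provides boundary edges, and [no_three_boundary_edges] allows only two. If the
    component has a second vertex, their inner ends can be taken distinct; otherwise both edges
    start at [x]. *)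
Lemma component_structure x :
  x \notin H ->
  double_nbr H x \/ exists d1 u1 d2 u2, attached x d1 u1 d2 u2.
Proof.
move=> Hx; have [h0 Hh0 _] := other_in_H x.
have [h1 Hh1 h10] := other_in_H h0.
have [d1 [u1 [cd1 Hd1 Hu1 e1 _]]] :=
  boundary_avoiding_outer e_2conn Hx Hh0 Hh1 h10.
have [h2 Hh2 h21] := other_in_H u1.
have [d3 [u3 [cd3 Hd3 Hu3 e3 u31]]] :=
  boundary_avoiding_outer e_2conn Hx Hu1 Hh2 h21.
have [/existsP[w /andP[wx cw]]|/existsPn alone] :=
  boolP [exists w, (w != x) && connect rW x w].
  right; have [y cy yd1] : exists2 y, connect rW x y & y != d1.
    have [xd1|] := eqVneq x d1; last by exists x.
    by exists w; rewrite // -xd1.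
  have Hy := delete_connectN cy Hx.
  have [d2 [u2 [cd2 Hd2 Hu2 e2 d21]]] :=
    boundary_avoiding_inner e_2conn Hy Hd1 yd1 Hu1.
  have{cy}cd2 := connect_trans cy cd2.
  have c1 d : connect rW x d -> connect rW d1 d.
    by apply: connect_trans; rewrite rW_sym.
  (* If [u1] and [u2] coincided, [d3 u3] would be a third boundary edge, since [u3] differs from
     [u1]. *)
  have u21 : u1 != u2.
    apply/eqP => u12;
      apply: (no_three_boundary_edges e_sym Hmax Hu1 Hu2 Hu3 Hd1 Hd2 e1 e2 e3);
      rewrite ?c1 // -?u12 ?[u1 == _]eq_sym ?u31 ?[d1 == _]eq_sym ?d21 ?orbT //.
  exists d1, u1, d2, u2; split=> //; first by rewrite eq_sym.
  move=> z v cz Hv ezv.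
  have [/andP[/eqP-> /eqP->]|n1] := boolP ((z == d1) && (v == u1));
    first by left.
  have [/andP[/eqP-> /eqP->]|n2] := boolP ((z == d2) && (v == u2));
    first by right.
  case: (no_three_boundary_edges e_sym Hmax Hu1 Hu2 Hv Hd1 Hd2 e1 e2 ezv) => //;
    rewrite ?c1 ?u21 //.
    by rewrite -negb_and andbC eq_sym [u1 == _]eq_sym.
  by rewrite -negb_and andbC eq_sym [u2 == _]eq_sym.
left; have cx d : connect rW x d -> d = x.
  by move=> cd; have := alone d; rewrite cd andbT negbK => /eqP.
rewrite (cx _ cd1) in e1; rewrite (cx _ cd3) in e3.
by exists u1, u3; split=> //; rewrite eq_sym.
Qed.

Lemma attached_swap x d1 u1 d2 u2 :
  attached x d1 u1 d2 u2 -> attached x d2 u2 d1 u1.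
Proof.
case=> -[d12 u12] [c1 c2] b1 b2 uB; split=> //.
- by rewrite eq_sym [u2 == _]eq_sym.
by move=> y u cy Hu eyu; have [] := uB y u cy Hu eyu; auto.
Qed.

(** [H] has a vertex [h] besides [u1] and [u2], and [h] has no neighbour in the component. A path of
    at most three edges from [y] to [h] must cross [d1 u1] or [d2 u2] with its second edge at the
    latest. *)
Lemma attached_near x d1 u1 d2 u2 y :
  x \notin H -> attached x d1 u1 d2 u2 -> connect rW x y ->
  [\/ y = d1, y = d2, e y d1 | e y d2].
Proof.
move=> Hx [[d12 u12] _ _ _ uB] cy; have Hy := delete_connectN cy Hx.
have [h Hh [h1 h2]] : exists2 h, h \in H & h <> u1 /\ h <> u2.
  have /card_gt0P[h] : 0 < #|H :\: [set u1; u2]|.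
    rewrite cardsD subn_gt0; apply: leq_ltn_trans H_gt2.
    apply: leq_trans (subset_leq_card (subsetIr _ _)) _.
    by rewrite cards2; case: (_ == _).
  rewrite !inE negb_or => /andP[/andP[/eqP h1 /eqP h2] Hh].
  by exists h.
have nB z : connect rW x z -> e z h -> False.
  by move=> cz ezh; have [[_ /h1]|[_ /h2]] := uB z h cz Hh ezh.
have step z w : connect rW x z -> w \notin H -> e z w -> connect rW x w.
  move=> cz Hw ezw; apply: (connect_trans cz); apply: delete_edge => //.
  exact: delete_connectN cz Hx.
have yh : y != h by apply: contraNneq Hy => ->.
have [/(nB _ cy)//|[a eya eah]|[a [b [eya eab ebh]]]] := near_cases yh.
  have [Ha|Ha] := boolP (a \in H).
    by have [[-> _]|[-> _]] := uB y a cy Ha eya; [apply: Or41 | apply: Or42].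
  by case: (nB a (step _ _ cy Ha eya) eah).
have [Ha|Ha] := boolP (a \in H).
  by have [[-> _]|[-> _]] := uB y a cy Ha eya; [apply: Or41 | apply: Or42].
have ca := step _ _ cy Ha eya.
have [Hb|Hb] := boolP (b \in H).
  have [[ad _]|[ad _]] := uB a b ca Hb eab; rewrite ad in eya.
    by apply: Or43.
  by apply: Or44.
by case: (nB b (step _ _ ca Hb eab) ebh).
Qed.

Lemma attached_parity x d1 u1 d2 u2 q :
  attached x d1 u1 d2 u2 -> path rW d1 q -> uniq (d1 :: q) -> last d1 q = d2 ->
  ~~ odd (size q) = s u1 (+) s u2.
Proof.
case=> -[d12 u12] _ [Hd1 Hu1 e1] [_ Hu2 e2] _ rq uq lq.
by apply: (odd_ear e_sym Hmax Hu1 Hu2 Hd1 rq uq e1); rewrite ?lq ?u12.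
Qed.

(** Suppose [x] is adjacent to [d1] and follow a path from [x] to [d2] avoiding [d1]. Its next
    vertex [z] cannot lie in [S], as [x] would have two neighbours there, nor be adjacent to [d2],
    because of the ear [d1 x z d2]. So [z] is again a neighbour of [d1], and the path never reaches
    [d2]. *)
Lemma fill_side S d1 d2 (C : T -> Prop) :
  d1 \in S -> d1 != d2 -> d2 \in S ->
  (forall v, v \notin S -> ~ double_nbr S v) ->
  (forall x y, x \notin S -> y \notin S -> C x -> C y -> x != y ->
    e d1 x -> e x y -> e y d2 -> False) ->
  (forall v w, C v -> e v w -> w \notin S -> C w) ->
  (forall v, C v -> v \notin S -> e v d1 \/ e v d2) ->
  forall x, C x -> x \notin S -> ~ e x d1.
Proof.
move=> Sd1 d12 Sd2 M1 M2 Cstep Cnear x Cx Sx exd1.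
have xd1 : x != d1 by apply: contraNneq Sx => ->.
have d21 : d2 != d1 by rewrite eq_sym.
have [q [eq uq lq qd1]] := path_avoiding e_2conn xd1 d21.
elim: q x {uq xd1} Cx Sx exd1 eq lq qd1 => [|z q IHq] x Cx Sx exd1 /=.
  by move=> _ xd2; rewrite xd2 Sd2 in Sx.
case/andP=> exz eq lq; rewrite inE negb_or => /andP[d1z qd1].
have [Sz|Sz] := boolP (z \in S).
  by apply: (M1 x Sx); exists d1, z.
have Cz := Cstep x z Cx exz Sz.
have [ezd1|ezd2] := Cnear z Cz Sz; first exact: IHq ezd1 eq lq qd1.
apply: (M2 x z) => //; last by rewrite e_sym.
by apply: contraTneq exz => ->; rewrite e_irr.
Qed.

(** [H] with an alternating tail from [u2] through [d2] to [d1] is properly connected. A maximal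
    extension admits neither a vertex with two neighbours in it nor an ear [d1 x y d2], and then
    [fill_side] leaves no vertex outside. *)
Lemma one_attached_component :
  (forall x y, x \notin H -> y \notin H -> ~ double_nbr H x ->
    ~ double_nbr H y ->
     connect rW x y) ->
  exists c', pconn e c' [set: T].
Proof.
move=> conn1; have sH := strong_bip Hmax.1.
have [trivial|] := classic (forall x, x \notin H -> double_nbr H x).
  by apply: (pconn_fill (strong_pconn sH)).
move=> ntriv; have [x0 nx] := not_all_ex_not _ _ ntriv.
have [Hx0 nx0] := imply_to_and _ _ nx.
have [/nx0[]|[d1 [u1 [d2 [u2 att]]]]] := component_structure Hx0.
have [[d12 u12] [cd1 cd2] [Hd1 Hu1 e1] [Hd2 Hu2 e2] uB] := att.
have cd12 : connect rW d1 d2 by apply: connect_trans cd2; rewrite rW_sym.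
have [p [rp up lp]] := connect_uniq_path cd12.
have [ep Hp] := delete_path rp.
pose q := rev (d1 :: p).
have Hq : ~~ has [in H] q by rewrite has_rev /= negb_or Hd1.
have eq : path e u2 q.
  rewrite /q -rev_belast_cons lp /= e_sym e2 /=.
  by rewrite -lp path_rev_belast.
have uq : uniq q by rewrite rev_uniq.
have [c0 [[a0 aq] pS0]] := pconn_pendant e_sym sH Hu2 eq uq Hq.
have [a1 ap] : exists a, apath e c0 a d1 p.
  move: aq; rewrite /q -rev_belast_cons => /and3P[_ _ /(apath_rev e_sym)].
  by rewrite last_rev_belast rev_belastK;
    exists (~~ (~~ a0 (+) odd (size (rev (belast d1 p))))).
have SE : H :|: [set z in q] = H :|: [set z in d1 :: p].
  by apply/setP=> z; rewrite !in_setU !in_set mem_rev.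
rewrite {}SE in pS0; set S0 := H :|: _ in pS0.
(* The path [p] is kept alternating, because ears between [d1] and [d2] are to close even cycles
   with it. *)
pose Q (S : {set T}) := exists c', pconn e c' S /\ apath e c' a1 d1 p.
have [S [S0S [c1 [pS apS]] maxS]] :=
  @maximal_set _ Q S0 (ex_intro _ c0 (conj pS0 ap)).
have HS : H \subset S by apply: subset_trans S0S; apply: subsetUl.
have Sp z : z \in d1 :: p -> z \in S.
  by move=> pz; apply: (subsetP S0S); rewrite in_setU in_set pz orbT.
have Sd1 : d1 \in S by apply: Sp; apply: mem_head.
have Sd2 : d2 \in S by apply: Sp; rewrite -lp mem_last.
have Sp' : all [in S] p by apply/allP => z pz; apply: Sp; rewrite inE pz orbT.
have keep c2 : (forall A : {set T}, A \subset S -> c2 A = c1 A) ->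
    apath e c2 a1 d1 p.
  move=> Dc2; rewrite -(@apath_congr _ e e c1 c2 S) // => z w Sz Sw.
  by rewrite Dc2 // subUset !sub1set Sz.
have M1 v : v \notin S -> ~ double_nbr S v.
  move=> Sv [u [u' [uu' Su Su' evu evu']]].
  have [c2 [Dc2 pS2]] := pconn_add e_sym pS Sv Su Su' uu' evu evu'.
  have Qv : Q (v |: S).
    exists c2; split=> //; apply: keep => A AS; apply: Dc2.
    by apply: contra Sv; apply: (subsetP AS).
  by have := maxS _ (subsetUr _ _) Qv; rewrite subUset sub1set (negPf Sv).
have HSN z : z \notin S -> z \notin H by apply: contra; apply: (subsetP HS).
have par := attached_parity att rp up lp.
have M2 x y : x \notin S -> y \notin S -> x != y ->
    e d1 x -> e x y -> e y d2 -> False.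
  move=> Sx Sy xy ed1x exy eyd2.
  have [xd1 xd2] : x != d1 /\ x != d2.
    by split; apply: contraNneq Sx => ->.
  have [yd1 yd2] : y != d1 /\ y != d2.
    by split; apply: contraNneq Sy => ->.
  (* This path from [d1] to [d2] has three edges, so by [par] the length of [p] is odd as well, and
     the two paths form an even cycle. *)
  have : ~~ odd (size [:: x; y; d2]) = s u1 (+) s u2.
    apply: (attached_parity att) => //=.
      by rewrite /rW /delete_vertices /= Hd1 Hd2 !HSN // ed1x exy eyd2.
    by rewrite !inE !negb_or xy yd2 xd2 d12 ![d1 == _]eq_sym xd1 yd1.
  rewrite /= -par => /esym/negbFE odp.
  have lpS : alink e c1 S a1 d1 d2 p by apply/and4P; split=> //; apply/eqP.
  have [||||||c2 [Dc2 pS2]] := @pconn_ear _ _ _ _ _ _ _ _ [:: y;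
    x] e_sym Sd1 lpS _ _ _ _ _ _ pS => //=.
  - by rewrite inE eq_sym xy.
  - by rewrite (negPf Sx) (negPf Sy).
  - by rewrite e_sym eyd2 e_sym exy e_sym ed1x.
  - by rewrite oddD odp.
  - by rewrite orbT.
  have Q2 : Q (S :|: [set z in [:: y; x]]) by exists c2; split=> //;
    apply: keep.
  have /subsetP/(_ x) := maxS _ (subsetUl _ _) Q2.
  by rewrite !inE eqxx !orbT (negPf Sx) => /(_ isT).
suff -> : [set: T] = S by exists c1.
apply/esym/eqP; rewrite -subTset; apply/subsetP=> x _.
have [//|Sx] := boolP (x \in S).
pose C z := connect rW x0 z.
have Cstep v w : C v -> e v w -> w \notin S -> C w.
  move=> Cv evw Sw; apply: (connect_trans Cv); apply: delete_edge => //.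
    exact: delete_connectN Cv Hx0.
  exact: HSN.
have Cnear v : C v -> v \notin S -> e v d1 \/ e v d2.
  move=> Cv Sv; have [vd|vd||] := attached_near Hx0 att Cv; auto.
    by rewrite vd Sd1 in Sv.
  by rewrite vd Sd2 in Sv.
have nbx : ~ double_nbr H x.
  case=> u [u' [uu' Hu Hu' exu exu']]; apply: (M1 x Sx).
  by exists u, u'; split=> //; apply: (subsetP HS).
have Cx : C x by apply: conn1 => //; apply: HSN.
have d21 : d2 != d1 by rewrite eq_sym.
have [exd1|exd2] := Cnear x Cx Sx.
  case: (@fill_side S d1 d2 C Sd1 d12 Sd2 M1 _ Cstep Cnear x Cx Sx exd1).
  by move=> y z Sy Sz _ _ yz ed1y eyz ezd2; apply: (M2 y z).
case: (@fill_side S d2 d1 C Sd2 d21 Sd1 M1 _ Cstep _ x Cx Sx exd2).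
  move=> y z Sy Sz _ _ yz ed2y eyz ezd1; apply: (M2 z y) => //.
  - by rewrite eq_sym.
  - by rewrite e_sym.
  - by rewrite e_sym.
  by rewrite e_sym.
by move=> v Cv Sv; have [] := Cnear v Cv Sv; auto.
Qed.

(** Here [w] has no neighbour in [H], and no edge joins its component to [d']. A path of at most
    three edges from [w] to [d'] must go through [d1] and [u1], or through [d2] and [u2], and enter
    [d'] from its only neighbour [u'] in [H]. *)
Lemma attached_far x d1 u1 d2 u2 x' d' u' w :
  x \notin H -> x' \notin H -> ~ connect rW x x' ->
  attached x d1 u1 d2 u2 -> connect rW x w -> w != d1 -> w != d2 ->
  connect rW x' d' -> u' \in H -> e d' u' ->
  (forall v, v \in H -> e d' v -> v = u') ->
  (u1 = u' /\ e w d1) \/ (u2 = u' /\ e w d2).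
Proof.
move=> Hx Hx' nxx' [_ _ _ _ uB] cw wd1 wd2 cd' Hu' eu' uB'.
have Hd' := delete_connectN cd' Hx'.
have far a : connect rW x a -> e a d' -> False.
  move=> ca ead'; apply: nxx'; apply: (connect_trans ca).
  apply: connect_trans (delete_edge (delete_connectN ca Hx) Hd' ead') _.
  by rewrite rW_sym.
have stay a b : connect rW x a -> b \notin H -> e a b -> connect rW x b.
  move=> ca Hb eab; apply: (connect_trans ca).
  exact: delete_edge (delete_connectN ca Hx) Hb eab.
have out a : e w a -> a \notin H.
  move=> ewa; apply/negP => Ha.
  by have [[wd _]|[wd _]] := uB w a cw Ha ewa; rewrite wd eqxx in wd1 wd2.
have wd' : w != d'.
  by apply/eqP => wd'; apply: nxx'; apply: (connect_trans cw);
    rewrite wd' rW_sym.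
have [/(far _ cw)//|[a ewa ead']|[a [b [ewa eab ebd']]]] := near_cases wd'.
  by case: (far a (stay _ _ cw (out _ ewa) ewa) ead').
have ca := stay _ _ cw (out _ ewa) ewa.
have [Hb|Hb] := boolP (b \in H);
  last by case: (far b (stay _ _ ca Hb eab) ebd').
have bu' : b = u' by apply: uB' => //; rewrite e_sym.
have [[ad bu]|[ad bu]] := uB a b ca Hb eab; [left | right];
  by rewrite -bu -ad.
Qed.

(** Suppose [w] is a third vertex. By [attached_far] towards [d1'] and [d2'], both components attach
    at the same two vertices and [w] is adjacent to [d1] and [d2]. The path [d1 w d2] has even
    length, hence so has a path from [d1'] to [d2'], which therefore has an inner vertex [y].
    Neither [w] nor [y] has a neighbour in [H], so a path of at most three edges between them avoids
    [H]. *)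
Lemma two_attached x d1 u1 d2 u2 x' d1' u1' d2' u2' w :
  x \notin H -> x' \notin H -> ~ connect rW x x' ->
  attached x d1 u1 d2 u2 -> attached x' d1' u1' d2' u2' -> connect rW x w ->
  w = d1 \/ w = d2.
Proof.
move=> Hx Hx' nxx' att att' cw.
have [|wd1] := eqVneq w d1; first by left.
have [|wd2] := eqVneq w d2; first by right.
have [[d12 u12] [cd1 cd2] [Hd1 Hu1 e1] [Hd2 Hu2 e2] uB] := att.
have [[d12' u12'] [cd1' cd2'] [Hd1' Hu1' e1'] [Hd2' Hu2' e2'] uB'] := att'.
have far1 : (u1 = u1' /\ e w d1) \/ (u2 = u1' /\ e w d2).
  apply: (attached_far Hx Hx' nxx' att cw wd1 wd2 cd1' Hu1' e1') => v Hv ev.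
  by have [[]//|[E]] := uB' d1' v cd1' Hv ev; rewrite E eqxx in d12'.
have far2 : (u1 = u2' /\ e w d1) \/ (u2 = u2' /\ e w d2).
  apply: (attached_far Hx Hx' nxx' att cw wd1 wd2 cd2' Hu2' e2') => v Hv ev.
  by have [[E]|[]//] := uB' d2' v cd2' Hv ev; rewrite E eqxx in d12'.
have [ewd1 ewd2 sE] : [/\ e w d1, e w d2 & s u1 (+) s u2 = s u1' (+) s u2'].
  case: far1 far2 => [[E1 ew1] [[E2 _]|[E2 ew2]]|[E1 ew2] [[E2 ew1]|[E2 _]]].
  - by rewrite -E1 -E2 eqxx in u12'.
  - by rewrite -E1 -E2.
  - by rewrite -E1 -E2 addbC.
  by rewrite -E1 -E2 eqxx in u12'.
have Hw := delete_connectN cw Hx.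
have : ~~ odd (size [:: w; d2]) = s u1 (+) s u2.
  apply: (attached_parity att) => //=.
    by rewrite /rW /delete_vertices /= Hd1 Hd2 Hw e_sym ewd1 ewd2.
  by rewrite !inE !negb_or eq_sym wd1 d12 wd2.
rewrite sE /= => par'.
have cd12' : connect rW d1' d2' by apply: connect_trans cd2'; rewrite rW_sym.
have [[|y p] [rp up lp]] := connect_uniq_path cd12'.
  by rewrite /= in lp; rewrite lp eqxx in d12'.
have := attached_parity att' rp up lp; rewrite -par'.
case: p rp up lp => [|y' p] // rp up lp _.
have cy : connect rW x' y.
  by move: rp => /= /andP[ry _]; apply: connect_trans cd1' (connect1 ry).
have yd1' : y != d1'.
  by apply: contraTneq up => ->; rewrite cons_uniq inE eqxx.
have yd2' : y != d2'.
  by apply: contraTneq up => ->; rewrite -lp /= mem_last andbF.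
have Hy := delete_connectN cy Hx'.
have nby v : e y v -> v \notin H.
  move=> eyv; apply/negP => Hv.
  by have [[yd _]|[yd _]] := uB' y v cy Hv eyv; rewrite yd eqxx in yd1' yd2'.
have nbw v : e w v -> v \notin H.
  move=> ewv; apply/negP => Hv.
  by have [[wd _]|[wd _]] := uB w v cw Hv ewv; rewrite wd eqxx in wd1 wd2.
case: nxx'; apply: (connect_trans cw).
apply: (@connect_trans _ _ y); last by rewrite rW_sym.
have [<-|wy] := eqVneq w y; first exact: connect0.
have [ewy|[a ewa eay]|[a [b [ewa eab eby]]]] := near_cases wy.
- exact: delete_edge.
- by apply: (connect_trans (delete_edge Hw (nbw a ewa) ewa));
    apply: delete_edge => //; apply: nbw.
have Hb : b \notin H by apply: nby; rewrite e_sym.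
apply: (connect_trans (delete_edge Hw (nbw a ewa) ewa)).
apply: (@connect_trans _ _ b); apply: delete_edge => //; exact: nbw.
Qed.

(** One of [a] and [b] lies outside the component of [x], so [two_attached] reduces this component
    to [d1] and [d2]. *)
Lemma component_edge a b x :
  a \notin H -> b \notin H -> ~ double_nbr H a -> ~ double_nbr H b ->
  ~ connect rW a b -> x \notin H -> ~ double_nbr H x ->
  exists x' u u', pendant_edge H x x' u u'.
Proof.
move=> Ha Hb na nb nab Hx nx.
have [y [Hy ny nxy]] : exists y, [/\ y \notin H, ~ double_nbr H y & ~ connect rW x y].
  have [cxa|nxa] := boolP (connect rW x a); last by exists a; split=> //;
    apply/negP.
  exists b; split=> // cxb; apply: nab; apply: connect_trans cxb.
  by rewrite rW_sym.
have [/nx[]|[d1 [u1 [d2 [u2 att]]]]] := component_structure Hx.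
have [/ny[]|[d1' [u1' [d2' [u2' att']]]]] := component_structure Hy.
wlog xd1 : d1 u1 d2 u2 att / x = d1.
  move=> IH; have [xd|xd] := two_attached Hx Hy nxy att att' (connect0 rW x).
    exact: (IH _ _ _ _ att).
  exact: (IH _ _ _ _ (attached_swap att)).
have in_d w := @two_attached _ _ _ _ _ _ _ _ _ _ w Hx Hy nxy att att'.
have [[d12 u12] [_ cd2] [Hd1 Hu1 e1] [Hd2 Hu2 e2] uB] := att.
have edge w : connect rW x w -> forall v, e w v -> v \notin H ->
  v = d1 \/ v = d2.
  move=> cw v ewv Hv; apply: in_d; apply: (connect_trans cw).
  by apply: delete_edge => //; apply: delete_connectN cw Hx.
exists d2, u1, u2; rewrite xd1 in cd2 edge uB *; split=> //.
- split=> //; case/connectP: cd2 => [[|y' p]] /=.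
    by move=> _ dE; rewrite dE eqxx in d12.
  case/andP=> /and3P[_ Hy' ed1y'] _ _.
  have [yd|<-//] := edge d1 (connect0 _ _) y' ed1y' Hy'.
  by rewrite yd e_irr in ed1y'.
- move=> w ed1w; have [Hw|Hw] := boolP (w \in H).
    have [[_ ->]|[dE _]] := uB d1 w (connect0 _ _) Hw ed1w; first by left.
    by rewrite dE eqxx in d12.
  have [wd|->] := edge d1 (connect0 _ _) w ed1w Hw; last by right.
  by rewrite wd e_irr in ed1w.
move=> w ed2w; have [Hw|Hw] := boolP (w \in H).
  have [[dE _]|[_ ->]] := uB d2 w cd2 Hw ed2w; last by left.
  by rewrite dE eqxx in d12.
have [->|wd] := edge d2 cd2 w ed2w Hw; first by right.
by rewrite wd e_irr in ed2w.
Qed.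

End Maximal.

(** * Pairs of pendant edges *)

Lemma pendant_edge_sym S z z' u u' :
  pendant_edge S z z' u u' -> pendant_edge S z' z u' u.
Proof.
case=> -[Sz Sz' Su Su' uu'] [ezz' ezu ez'u'] nz nz'; split=> //.
  by split=> //; rewrite eq_sym.
by split=> //; rewrite e_sym.
Qed.

Lemma pendant_edge_neq S z z' u u' w w' t t' :
  pendant_edge S z z' u u' -> pendant_edge S w w' t t' ->
  w != z -> w != z' -> w' != z /\ w' != z'.
Proof.
case=> -[Sz Sz' Su Su' uu'] [ezz' ezu ez'u'] nz nz'.
case=> -[Sw Sw' St St' tt'] [eww' ewt ew't'] nw nw' wz wz'.
have ew'w : e w' w by rewrite e_sym.
split; apply/eqP => E; rewrite E in ew'w.
  by have [wu|wE] := nz _ ew'w; [rewrite wu Su in Sw | rewrite wE eqxx in wz'].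
by have [wu|wE] := nz' _ ew'w; [rewrite wu Su' in Sw | rewrite wE eqxx in wz].
Qed.

(** The four cases are the possible short paths [z u w], [z u t w], [z z' u' w] and [z u w' w]. *)
Lemma pendant_edge_near S z z' u u' w w' t t' :
  pendant_edge S z z' u u' -> pendant_edge S w w' t t' ->
  w != z -> w != z' -> [\/ u = t, e u t, u' = t | u = t'].
Proof.
case=> -[Sz Sz' Su Su' uu'] [ezz' ezu ez'u'] nz nz'.
case=> -[Sw Sw' St St' tt'] [eww' ewt ew't'] nw nw' wz wz'.
have SN v v' : v \in S -> v' \notin S -> v <> v'.
  by move=> Sv Sv' E; rewrite -E Sv in Sv'.
have N x : e z x -> x <> w.
  move=> ezx E; have [xu|xz'] := nz _ ezx.
    by apply: (SN u w Su Sw); rewrite -xu.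
  by rewrite -E xz' eqxx in wz'.
have N' x : e z' x -> x <> w.
  move=> ezx E; have [xu|xz'] := nz' _ ezx.
    by apply: (SN u' w Su' Sw); rewrite -xu.
  by rewrite -E xz' eqxx in wz.
have zw : z != w by rewrite eq_sym.
have [/N//|[a eza eaw]|[a [b [eza eab ebw]]]] := near_cases zw.
  have [aE|aE] := nz _ eza; rewrite {}aE in eaw; last by case: (N' _ eaw).
  have [|uE|uE] := nw u _;
    [by rewrite e_sym | by apply: Or41 | by case: (SN u w')].
have [aE|aE] := nz _ eza; rewrite {}aE {a eza} in eab.
  have [|bE|bE] := nw b _; first by rewrite e_sym.
    by rewrite bE in eab; apply: Or42.
  rewrite bE in eab; have [|uE|uE] := nw' u _; first by rewrite e_sym.
    exact: Or44.
  by case: (SN u w).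
have [bE|bE] := nz' _ eab; rewrite bE in ebw; last by case: (N _ ebw).
have [|uE|uE] := nw u' _;
  [by rewrite e_sym | by apply: Or43 | by case: (SN u' w')].
Qed.

Lemma subset2 S u v : ([set u; v] \subset S) = (u \in S) && (v \in S).
Proof. by rewrite subUset !sub1set. Qed.

(** * Several pendant edges *)

Section MaximalStrong.
Variables (c : {set T} -> bool) (S : {set T}).
Hypothesis S_strong : strong e c S.
Hypothesis S_max : forall c' (S' : {set T}),
  S \subset S' -> strong e c' S' -> S' \subset S.

Lemma strong_subset c' (Z : {set T}) u :
  (forall A : {set T}, A \subset S -> c' A = c A) -> strong e c' Z ->
  u \in S -> u \in Z -> Z \subset S.
Proof.
move=> Dc' sZ Su Zu; apply: subset_trans (subsetUr S Z) _.
apply: (S_max (c' := c')); first exact: subsetUl.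
apply: (strongU _ sZ Su Zu); apply: strong_congr S_strong => v w Sv Sw.
by rewrite Dc' // subset2 Sv.
Qed.

(** With a path of odd length, the three edges [u z], [z z'], [z' u'] would close an even cycle and
    enlarge [S]. *)
Lemma pendant_edge_even z z' u u' a p :
  pendant_edge S z z' u u' -> alink e c S a u' u p -> ~~ odd (size p).
Proof.
case=> -[Sz Sz' Su Su' uu'] [ezz' ezu ez'u'] nz nz' lp; apply/negP => op.
have zz' : z != z' by apply: contraTneq ezz' => ->; rewrite e_irr.
have [||||||c' [Dc' sS']] :=
  @strong_ear _ _ _ _ _ _ _ _ [:: z; z'] e_sym Su' lp _ _ _ _ _ _ S_strong =>
    //=.
- by rewrite inE zz'.
- by rewrite (negPf Sz) (negPf Sz').
- by rewrite e_sym ezu ezz' ez'u'.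
- by rewrite oddD op.
- by rewrite orbT.
have /subsetP/(_ z) := S_max (subsetUl _ _) sS'.
by rewrite !inE eqxx orbT (negPf Sz) => /(_ isT).
Qed.

(** The hexagon [u z z' u' w' w] has no edge inside [S], so it can be coloured alternately and would
    enlarge [S]. *)
Lemma pendant_edges_not_parallel z z' w w' u u' :
  pendant_edge S z z' u u' -> pendant_edge S w w' u u' ->
  w != z -> w != z' -> False.
Proof.
move=> pz pw wz wz'; have [w'z w'z'] := pendant_edge_neq pz pw wz wz'.
case: pz => -[Sz Sz' Su Su' uu'] [ezz' ezu ez'u'] _ _.
case: pw => -[Sw Sw' _ _ _] [eww' ewu ew'u'] _ _.
have SN v v' : v \in S -> v' \notin S ->
  ((v == v') = false) * ((v' == v) = false).
  by move=> Sv Sv'; split; apply: contraNF Sv' => /eqP; [move <- | move ->].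
have NE (v v' : T) : v != v' -> ((v == v') = false) * ((v' == v) = false).
  by rewrite [v' == v]eq_sym => /negPf.
have zz' : z != z' by apply: contraTneq ezz' => ->; rewrite e_irr.
have ww' : w != w' by apply: contraTneq eww' => ->; rewrite e_irr.
have nS := (negPf Sz, negPf Sz', negPf Sw, negPf Sw').
have neqs := (NE _ _ uu', NE _ _ zz', NE _ _ ww', NE _ _ wz, NE _ _ wz',
  NE _ _ w'z, NE _ _ w'z', SN _ _ Su Sz, SN _ _ Su Sz', SN _ _ Su Sw,
  SN _ _ Su Sw', SN _ _ Su' Sz, SN _ _ Su' Sz', SN _ _ Su' Sw, SN _ _ Su' Sw').
(* On the hexagon this gives [true] to [u z], [z' u'], [w' w] and [false] to the other three
   edges. *)
pose c' (A : {set T}) := if A \subset S then c A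
  else (A \subset ~: S) (+) ((z \in A) || (z' \in A)).
have Dc' (A : {set T}) : A \subset S -> c' A = c A by rewrite /c' => ->.
have sC : strong e c' [set v in [:: u; z; z'; u'; w'; w]].
  apply: (@alternating_cycle_strong _ _ _ true) => //=.
    by rewrite !inE !neqs.
  rewrite ezz' ez'u' [e u z]e_sym ezu [e u' w']e_sym ew'u' [e w' w]e_sym eww' ewu /=.
  by rewrite /c' !subset2 !inE Su Su' !nS !eqxx !neqs.
have := strong_subset Dc' sC Su; rewrite !inE eqxx => /(_ isT)/subsetP/(_ z).
by rewrite !inE eqxx orbT (negPf Sz) => /(_ isT).
Qed.

(* Two pendant edges with attachments [u, u'] and [u, t'], where [u'] and [t']
   are adjacent: the edge [u' t'] would close an odd alternating path from [u']
   or from [t'] to [u], against [pendant_edge_even]. *)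
Lemma pendant_edges_adjacent z z' w w' u u' t' :
  pendant_edge S z z' u u' -> pendant_edge S w w' u t' ->
  e u' t' -> False.
Proof.
move=> pz pw eut; have [[Sz Sz' Su Su' uu'] _ _ _] := pz.
have [[_ _ _ St' ut'] _ _ _] := pw.
have u'u : u' != u by rewrite eq_sym.
set k := c [set u'; t'].
have [p lp] := S_strong (~~ k) Su' Su u'u.
have op := pendant_edge_even pz lp.
have /and4P[ap up /eqP lpu Sp] := lp.
(* If [p] avoids [t'], prefix it with the edge [t' u']; otherwise replace its part up to [t'] by the
   edge [u' t']. *)
have [pt'|pt'] := boolP (t' \in p); last first.
  have lt : alink e c S k t' u (u' :: p).
    apply/and4P; split=> /=.
    - by rewrite e_sym eut setUC eqxx.
    - rewrite inE negb_or pt' andbT; apply/andP; split=> //.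
      by apply: contraTneq eut => ->; rewrite e_irr.
    - by rewrite lpu.
    by rewrite Su'.
  by have := pendant_edge_even pw lt; rewrite /= op.
case/path.splitP: pt' => p1 p2 in ap up lpu Sp lp op.
move: ap up; rewrite apath_cat last_rcons size_rcons -cat_cons cat_uniq.
move=> /andP[_ ap2] /and3P[_ np up2].
have lt : alink e c S (~~ k (+) odd (size p1).+1) t' u p2.
  apply/and4P; split=> //.
  - rewrite cons_uniq up2 andbT; apply: contra np => p2t.
    by apply/hasP; exists t'; rewrite // inE mem_rcons mem_head orbT.
  - by rewrite -lpu last_cat last_rcons.
  by move: Sp; rewrite all_cat => /andP[].
have op2 := pendant_edge_even pw lt.
(* As [p] and [p2] both have even length, [p2] starts with [~~ k] and may follow the edge [u' t'] of
   colour [k]; the result has odd length. *)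
have lu : alink e c S k u' u (t' :: p2).
  apply/and4P; split.
  - rewrite /= eut eqxx /=; move: ap2; congr apath.
    move: op; rewrite size_cat size_rcons oddD (negPf op2) addbF => /negPf ->.
    by rewrite addbF.
  - have : ~~ has [in u' :: rcons p1 t'] (p2) := np.
    rewrite !cons_uniq up2 andbT inE negb_or => np'; apply/andP; split.
      apply/andP; split; first by apply: contraTneq eut => ->; rewrite e_irr.
      by apply: contra np' => p2u; apply/hasP; exists u'; rewrite // inE eqxx.
    by apply: contra np' => p2t; apply/hasP; exists t';
      rewrite // inE mem_rcons mem_head orbT.
  - by rewrite -lpu last_cat last_rcons.
  by rewrite /= St'; move: Sp; rewrite all_cat => /andP[].
by have := pendant_edge_even pz lu; rewrite /= op2.
Qed.

(** Apply the distance condition to the other ends [z'] and [w']: either [u'] and [t'] coincide or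
    are adjacent, both excluded above, or one of the edges would have equal attachments. *)
Lemma pendant_edges_share z z' w w' u u' t t' :
  pendant_edge S z z' u u' -> pendant_edge S w w' t t' ->
  w != z -> w != z' -> u <> t.
Proof.
move=> pz pw wz wz' ut; rewrite -{}ut {t} in pw.
have [w'z w'z'] := pendant_edge_neq pz pw wz wz'.
have [[_ _ _ _ uu'] _ _ _] := pz; have [[_ _ _ _ ut'] _ _ _] := pw.
case: (pendant_edge_near (pendant_edge_sym pz) (pendant_edge_sym pw) w'z' w'z).
- by move=> E; rewrite -E in pw; apply: pendant_edges_not_parallel pz pw wz wz'.
- exact: pendant_edges_adjacent pz pw.
- by move=> E; rewrite E eqxx in ut'.
by move=> E; rewrite E eqxx in uu'.
Qed.

(** The four attachments are distinct, so the distance condition makes [u t] and [u' t'] edges. If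
    both had colour [true], the 8-cycle [u z z' u' t' w' w t] could be made alternating without
    recolouring [S]. *)
Lemma pendant_edges_bridge z z' w w' u u' t t' :
  pendant_edge S z z' u u' -> pendant_edge S w w' t t' ->
  w != z -> w != z' ->
  exists f g, [/\ f = u \/ f = u', g = t \/ g = t', e f g & c [set f;
    g] = false].
Proof.
move=> pz pw wz wz'; have [w'z w'z'] := pendant_edge_neq pz pw wz wz'.
have pz' := pendant_edge_sym pz; have pw' := pendant_edge_sym pw.
have ut := pendant_edges_share pz pw wz wz'.
have ut' := pendant_edges_share pz pw' w'z w'z'.
have u't := pendant_edges_share pz' pw wz' wz.
have u't' := pendant_edges_share pz' pw' w'z' w'z.
have [//|eut|//|//] := pendant_edge_near pz pw wz wz'.
have [//|eu't'|//|//] := pendant_edge_near pz' pw' w'z' w'z.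
have [cut|cut] := boolP (c [set u; t]); last first.
  by exists u, t; split; auto; apply: negbTE.
have [cut'|cut'] := boolP (c [set u'; t']); last first.
  by exists u', t'; split; auto; apply: negbTE.
case: pz => -[Sz Sz' Su Su' uu'] [ezz' ezu ez'u'] _ _.
case: pw => -[Sw Sw' St St' tt'] [eww' ewt ew't'] _ _.
have SN v v' : v \in S -> v' \notin S ->
  ((v == v') = false) * ((v' == v) = false).
  by move=> Sv Sv'; split; apply: contraNF Sv' => /eqP; [move <- | move ->].
have NE (v v' : T) : v != v' -> ((v == v') = false) * ((v' == v) = false).
  by rewrite [v' == v]eq_sym => /negPf.
have zz' : z != z' by apply: contraTneq ezz' => ->; rewrite e_irr.
have ww' : w != w' by apply: contraTneq eww' => ->; rewrite e_irr.
have nS := (negPf Sz, negPf Sz', negPf Sw, negPf Sw').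
have neqs :=
  (NE _ _ uu', NE _ _ zz', NE _ _ ww', NE _ _ tt', NE _ _ wz, NE _ _ wz',
  NE _ _ w'z, NE _ _ w'z', SN _ _ Su Sz, SN _ _ Su Sz', SN _ _ Su Sw,
  SN _ _ Su Sw', SN _ _ Su' Sz, SN _ _ Su' Sz', SN _ _ Su' Sw, SN _ _ Su' Sw',
  SN _ _ St Sz, SN _ _ St Sz', SN _ _ St Sw, SN _ _ St Sw', SN _ _ St' Sz,
  SN _ _ St' Sz', SN _ _ St' Sw, SN _ _ St' Sw',
  (NE _ _ (introN eqP ut), NE _ _ (introN eqP ut'), NE _ _ (introN eqP u't),
   NE _ _ (introN eqP u't'))).
(* Edges leaving [S] get [false] here, to alternate with the two edges of colour [true] in [S]; the
   final colouring takes the opposite values. *)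
pose c' (A : {set T}) := if A \subset S then c A else A \subset ~: S.
have Dc' (A : {set T}) : A \subset S -> c' A = c A by rewrite /c' => ->.
have sC : strong e c' [set v in [:: u; z; z'; u'; t'; w'; w; t]].
  apply: (@alternating_cycle_strong _ _ _ false) => //=.
    by rewrite !inE !neqs.
  rewrite ezz' ez'u' [e u z]e_sym ezu eu't' [e t' w']e_sym ew't' [e w' w]e_sym eww'.
  rewrite ewt [e t u]e_sym eut /=.
  rewrite /c' !subset2 !inE Su Su' St St' !nS /= cut'.
  by rewrite [[set t; u]]setUC cut.
have := strong_subset Dc' sC Su; rewrite !inE eqxx => /(_ isT)/subsetP/(_ z).
by rewrite !inE eqxx orbT (negPf Sz) => /(_ isT).
Qed.

Lemma pendant_edge_double S' x x' u u' :
  pendant_edge S' x x' u u' -> ~ double_nbr S' x.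
Proof.
case=> -[Sx Sx' _ _ _] _ nx _ [v [v' [vv' Sv Sv' exv exv']]].
have nbu w : w \in S' -> e x w -> w = u.
  by move=> Sw /nx[//|wx]; rewrite wx (negPf Sx') in Sw.
by rewrite (nbu v) // (nbu v') // eqxx in vv'.
Qed.

(** A pendant vertex enters [S] by an edge coloured [true] and continues with [false]; two pendant
    edges are joined through a bridge of colour [false]. The remaining vertices have two neighbours
    in [S] and are left to [pconn_fill]. *)
Lemma pconn_pendant_edges :
  (forall x, x \notin S -> double_nbr S x \/
     exists x' u u', pendant_edge S x x' u u') ->
  exists c', pconn e c' [set: T].
Proof.
move=> S_out.
pose dbl x :=
  [exists u, exists u', [&& u != u', u \in S, u' \in S, e x u & e x u']].
have dblP x : reflect (double_nbr S x) (dbl x).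
  apply: (iffP existsP) => [[u /existsP[u' /and5P[*]]]|[u [u' [*]]]].
    by exists u, u'.
  by exists u; apply/existsP; exists u'; apply/and5P.
pose R := [set x | (x \notin S) && ~~ dbl x].
have RP x : x \in R -> exists x' u u', [/\ pendant_edge S x x' u u' & x' \in R].
  rewrite inE => /andP[Sx /dblP nx].
  have [//|[x' [u [u' px]]]] := S_out x Sx; exists x', u, u'; split=> //.
  rewrite inE; apply/andP; split; first by case: px => -[].
  by apply/dblP; apply: pendant_edge_double (pendant_edge_sym px).
pose c' (A : {set T}) := if A \subset S then c A else ~~ (A \subset ~: S).
have cS x y : x \in S -> y \in S -> c' [set x; y] = c [set x; y].
  by move=> Sx Sy; rewrite /c' subset2 Sx Sy.
have cm x y : x \in S -> y \notin S -> c' [set x; y] = true.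
  by move=> Sx Sy; rewrite /c' !subset2 !inE Sx (negPf Sy).
have cm' x y : x \in S -> y \notin S -> c' [set y; x] = true.
  by move=> Sx Sy; rewrite setUC cm.
have co x y : x \notin S -> y \notin S -> c' [set x; y] = false.
  by move=> Sx Sy; rewrite /c' !subset2 !inE (negPf Sx) (negPf Sy).
have sS' : strong e c' S.
  by apply: strong_congr S_strong => x y Sx Sy; rewrite cS.
have NE (v v' : T) : v != v' -> ((v == v') = false) * ((v' == v) = false).
  by rewrite [v' == v]eq_sym => /negPf.
have SN v v' : v \in S -> v' \notin S ->
  ((v == v') = false) * ((v' == v) = false).
  by move=> Sv Sv'; apply: NE; apply: contraNneq Sv' => <-.
pose X := S :|: R.
have toS z h : z \in R -> h \in S -> exists a p, alink e c' X a z h p.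
  move=> Rz Sh;
    have [z' [u [u' [[[Sz Sz' Su Su' uu'] [ezz' ezu ez'u'] _ _] Rz']]]] :=
    RP z Rz.
  have [p /and4P[ap up lp Sp]] : exists p, alink e c' S (~~ true) u h p.
    have [->|uh] := eqVneq u h; last exact: sS'.
    by exists [::]; rewrite /alink /= eqxx.
  exists true, (u :: p); apply/and4P; split=> //.
  - by rewrite /= ezu cm'.
  - rewrite cons_uniq up andbT inE negb_or (SN u z) //=.
    by apply: contra Sz => /(allP Sp).
  apply/allP => v; rewrite inE /X => /orP[/eqP->|/(allP Sp) Sv]; apply/setUP;
    by left.
have RR z w : z \in R -> w \in R -> z != w -> exists a p, alink e c' X a z w p.
  move=> Rz Rw zw; have [z' [u [u' [pz Rz']]]] := RP z Rz.
  have [w' [t [t' [pw Rw']]]] := RP w Rw.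
  have wz : w != z by rewrite eq_sym.
  have [[Sz Sz' Su Su' uu'] [ezz' ezu ez'u'] _ _] := pz.
  have [->|wz'] := eqVneq w z'.
    exists false, [:: z'];
      rewrite /alink /= ezz' co // !eqxx inE /X inE Rz' orbT !andbT /=.
    by apply: contraTneq ezz' => ->; rewrite e_irr.
  have [f [g [fu gt efg cfg]]] := pendant_edges_bridge pz pw wz wz'.
  have [w'z w'z'] := pendant_edge_neq pz pw wz wz'.
  have [[Sw Sw' St St' tt'] [eww' ewt ew't'] _ _] := pw.
  have [Sf Sg] : f \in S /\ g \in S by case: fu gt => -> [] ->.
  have zz' : z != z' by apply: contraTneq ezz' => ->; rewrite e_irr.
  have ww' : w != w' by apply: contraTneq eww' => ->; rewrite e_irr.
  have fg : f != g by apply: contraTneq efg => ->; rewrite e_irr.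
  have neqs := (NE _ _ zz', NE _ _ ww', NE _ _ fg, NE _ _ wz, NE _ _ wz',
    NE _ _ w'z, NE _ _ w'z', SN _ _ Sf Sz, SN _ _ Sf Sz', SN _ _ Sf Sw,
    SN _ _ Sf Sw', SN _ _ Sg Sz, SN _ _ Sg Sz', SN _ _ Sg Sw, SN _ _ Sg Sw').
  have Xs : (z \in X) * (z' \in X) * (f \in X) * (g \in X) * (w \in X) * (w' \in X).
    by rewrite /X !in_setU Rz Rz' Sf Sg Rw Rw' !orbT.
  have cols := (cm' f z Sf Sz, cm' f z' Sf Sz', cm g w Sg Sw, cm g w' Sg Sw',
    cS f g Sf Sg, cfg, co z z' Sz Sz', co w' w Sw' Sw).
  (* The beginning of the path is chosen independently of its end [q]: [z f] if [f = u], and the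
     detour [z z' f] if [f = u']. *)
  have [l1 [a l1P]] : exists (b : bool) a, forall q,
      alink e c' X false f w (g :: q) -> z \notin q -> z' \notin q ->
      alink e c' X a z w (if b then f :: g :: q else z' :: f :: g :: q).
    case: fu => fE.
      exists true, true => q /and4P[/= aq /andP[fq uq] lq Xq] qz qz'.
      apply/and4P; split=> //=; last by rewrite Xs.
        by move: aq; have ezf : e z f := etrans (congr1 (e z) fE) ezu;
          rewrite ezf !cols.
      by rewrite fq uq !inE !neqs (negPf qz).
    exists false, false => q /and4P[/= aq /andP[fq uq] lq Xq] qz qz'.
    apply/and4P; split=> //=; last by move: Xq; rewrite /= !Xs.
      by move: aq; have ez'f : e z' f := etrans (congr1 (e z') fE) ez'u';
        rewrite ezz' ez'f !cols.
    by rewrite fq uq !inE !neqs (negPf qz) (negPf qz').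
  (* Likewise at the far end: directly from [g] to [w] if [g = t], and through [w'] if [g = t']. *)
  exists a; case: gt => gE.
    have egw : e g w by rewrite gE e_sym.
    eexists; apply: (l1P [:: w]); last 2 first.
    - by rewrite !inE !neqs.
    - by rewrite !inE !neqs.
    by rewrite /alink /= !Xs !inE !neqs efg !cols egw !eqxx.
  have egw' : e g w' by rewrite gE e_sym.
  have ew'w : e w' w by rewrite e_sym.
  eexists; apply: (l1P [:: w'; w]); last 2 first.
  - by rewrite !inE !neqs.
  - by rewrite !inE !neqs.
  by rewrite /alink /= !Xs !inE !neqs efg !cols egw' ew'w !eqxx.
have pX : pconn e c' X.
  move=> x y Ax Ay xy; have [Sx|Rx] := setUP Ax; have [Sy|Ry] := setUP Ay.
  - have [p lp] := sS' x y true Sx Sy xy.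
    by exists true, p; apply: alink_sub lp; apply: subsetUl.
  - have [a [p lp]] := toS y x Ry Sx.
    have [b [q [lq _]]] := alink_sym e_sym Ay lp.
    by exists b, q.
  - exact: toS.
  exact: RR.
apply: (pconn_fill pX) => v; rewrite in_setU negb_or inE => /andP[Sv].
rewrite Sv negbK => /dblP[u [u' [uu' Su Su' evu evu']]].
by exists u, u'; split=> //; apply/setUP; left.
Qed.

End MaximalStrong.

Theorem proper_two_coloring : exists c, pconn e c [set: T].
Proof.
have [[x [q [uq eq oq q_gt1]]]|[x [q [uq eq qT]]]] :=
  even_cycle_or_hamiltonian e_sym e_irr e_2conn; last first.
  have [c [_ aq]] := recolor_path (fun=> true) true uq eq.
  exists c; have -> : [set: T] = [set z in x :: q].
    by apply/setP=> z; rewrite !in_set qT.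
  exact: pconn_apath aq uq.
(* A single vertex is trivially strong, and the even cycle is an ear from [x] to itself. *)
have [s0 [c0 sH0]] : exists s c, strong (bip e s) c ([set x] :|: [set z in q]).
  apply: (@bip_ear _ _ e_sym (fun=> true) (fun=> true) [set x] x x) => //.
  - by move=> y z a; rewrite !inE => /eqP-> /eqP->; rewrite eqxx.
  - by rewrite inE.
  - by rewrite inE.
  - by case: (q) q_gt1.
  - by case/andP: uq.
  - by apply/hasPn => z qz; rewrite inE; apply: contraTneq qz => ->;
      case/andP: uq.
  - by rewrite oq.
  by rewrite q_gt1 orbT.
have [H [H0H [s [c sH]] maxH]] := @maximal_set _
  (fun H => exists s c, strong (bip e s) c H) _ (ex_intro _ s0 (ex_intro _ c0 sH0)).
have Hmax : bip_maximal e s c H.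
  by split=> // s' c' H' HH' sH'; apply: maxH => //; exists s', c'.
have H_gt2 : 2 < #|H|.
  apply: leq_trans (subset_leq_card H0H).
  have -> : [set x] :|: [set z in q] = [set z in x :: q].
    by apply/setP=> z; rewrite !inE.
  by rewrite cardsE (card_uniqP uq).
have [|nconn] := classic (forall x y, x \notin H -> y \notin H ->
    ~ double_nbr H x -> ~ double_nbr H y -> connect (delete_vertices e H) x y).
  exact: one_attached_component Hmax H_gt2.
have [a [b [Ha Hb na nb nab]]] : exists a b, [/\ a \notin H, b \notin H,
    ~ double_nbr H a, ~ double_nbr H b & ~ connect (delete_vertices e H) a b].
  apply: NNPP => none; apply: nconn => a b Ha Hb na nb; apply: NNPP => nab.
  by apply: none; exists a, b.
have sHe := strong_bip sH.
(* [S] is maximal without regard to any bipartition, as the cycles through pendant edges require. *)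
have [S [HS [c1 sS] maxS]] :=
  @maximal_set _ (fun S => exists c, strong e c S) H (ex_intro _ c sHe).
apply: (pconn_pendant_edges sS) => [c' S' SS' sS'|y Sy].
  by apply: maxS => //; exists c'.
have Hy : y \notin H by apply: contra Sy; apply: (subsetP HS).
have [[u [u' [uu' Hu Hu' eyu eyu']]]|ny] := classic (double_nbr H y).
  by left; exists u, u'; split=> //; apply: (subsetP HS).
have [y' [u [u' py]]] := component_edge Hmax H_gt2 Ha Hb na nb nab Hy ny.
have [[_ Hy' Hu Hu' uu'] [eyy' eyu ey'u'] n n'] := py.
(* A pendant edge on [H] remains one on [S] unless its other end [y'] was absorbed; then [y] has the
   two neighbours [u] and [y'] in [S]. *)
have [Sy'|Sy'] := boolP (y' \in S).
  left; exists u, y'; split=> //; last exact: (subsetP HS).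
  by apply: contraNneq Hy' => <-.
by right; exists y', u, u'; split=> //; split=> //; apply: (subsetP HS).
Qed.

End Diameter.

(** * From boolean colourings to the proper connection number *)

Lemma apath_sorted (T : finType) (K : eqType) (f : bool -> K) (r : rel T)
    (c : {set T} -> bool) a x p :
  injective f -> apath r c a x p ->
  sorted (fun k l => k != l) (path_colors (f \o c) x p).
Proof.
move=> f_inj; elim: p a x => //= y [//|z p] IHp a x /and3P[_ /eqP cxy ap].
rewrite /= in IHp *; rewrite (IHp (~~ a) y ap) andbT (inj_eq f_inj) cxy.
by move: ap => /= /and3P[_ /eqP-> _]; case: (a).
Qed.

(** With at most one colour, consecutive edges never differ, so a proper path between distinct
    vertices is a single edge. *)
Lemma proper_connectable1_complete (T : finType) (e : rel T) t :
  t <= 1 -> proper_connectable e t -> complete_graph e.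
Proof.
move=> t1 [c pc] x y xy; have [p /andP[/and3P[ep _ /eqP lp] sp]] := pc x y xy.
case: p ep lp sp => [|z [|w p]] /=.
- by move=> _ xE; rewrite xE eqxx in xy.
- by rewrite andbT => exz <-.
move=> _ _ /andP[/eqP[]]; apply: val_inj => /=.
have lt0 (i : 'I_t) : i = 0 :> nat by case: i => i lt_i /=;
  case: i lt_i (leq_trans lt_i t1).
by rewrite !lt0.
Qed.

Theorem theorem3p2 (T : finType) (e : rel T)
    (e_sym : symmetric e) (e_irr : irreflexive e)
    (e_2conn : k_connected e 2) (e_noncomplete : ~ complete_graph e)
    (e_diam : diam e = 3) :
  is_pc e 2.
Proof.
split; last first.
  move=> t pc; rewrite leqNgt; apply/negP => t1.
  exact/e_noncomplete/(proper_connectable1_complete t1 pc).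
have near x y : exists p, [/\ path e x p, last x p = y & size p <= 3].
  have cxy : connect e x y.
    have [_ /(_ set0)] := e_2conn; rewrite cards0 => /(_ isT x y); rewrite !inE.
    case/(_ isT isT)/connectP=> p /delete_path[ep _] ->.
    by apply/connectP; exists p.
  have [|p [ep lp] sp] := (dist_leP 3 cxy).1; last by exists p.
  rewrite -e_diam; apply: leq_trans (leq_bigmax (F := fun x => \max_y dist e x y) x).
  exact: (leq_bigmax (F := dist e x)).
have [c pc] := proper_two_coloring e_sym e_irr e_2conn near.
pose f (b : bool) : 'I_2 := if b then ord_max else ord0.
exists (f \o c) => x y xy.
have [a [p /and4P[ap up lp _]]] := pc x y (in_setT x) (in_setT y) xy.
exists p; rewrite /proper_path /simple_path (apath_path ap) up lp /=.
by apply: apath_sorted ap => -[] [].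
Qed.
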